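(* Let $n\ge1$ and suppose $\underline{\mathbf a}=(a_1,\dots,a_n)\in(\mathcal K^\times)^n$ is descending. Then the map \[ \operatorname{Ind}_{\mathrm{S}\mathcal H}^{\mathcal H(\mathcal Y)}\big(\{\underline{\mathbf a}\}\boxtimes\mathrm{sgn}\big)\to\operatorname{Ind}_{\mathcal K[\mathcal Y]}^{\mathcal H(\mathcal Y)}\underline{\mathbf a},\qquad 1\otimes\underline u\mapsto \mathbf e_n\otimes\underline v, \] is a well-defined isomorphism of $\mathcal H(\mathcal Y)$-modules.
   Context: $\mathcal K$ is a field of characteristic $0$ and $t\in\mathcal K^\times$ with $(t^m-1)/(t-1)\neq0$ for all $m\neq0$. The finite Hecke algebra $\mathcal H^{f}_n$ is generated by $T_1,\dots,T_{n-1}$ with braid relations $T_iT_{i+1}T_i=T_{i+1}T_iT_{i+1}$, $T_iT_j=T_jT_i$ ($|i-j|\ge2$), and $(T_i-t)(T_i+t^{-1})=0$. The affine Hecke algebra $\mathcal H(\mathcal Y)$ is generated by $\mathcal H^f_n$ and the Laurent polynomial ring $\mathcal K[\mathcal Y]=\mathcal K[Y_1^{\pm1},\dots,Y_n^{\pm1}]$ with relations $T_iY_iT_i=Y_{i+1}$ ($1\le i\le n-1$) and $T_iY_j=Y_jT_i$ for $j\neq i,i+1$. Let $S(\mathcal Y)=\mathcal K[\mathcal Y]^{\mathfrak S_n}$ and let $\mathrm S\mathcal H$ be the subalgebra generated by $\mathcal H^f_n$ and $S(\mathcal Y)$. Write $\underline{\mathbf a}=\mathcal K\underline v$ for the one-dimensional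 $\mathcal K[\mathcal Y]$-module on which $Y_i$ acts by $a_i$, and $\{\underline{\mathbf a}\}\boxtimes\mathrm{sgn}=\mathcal K\underline u$ for the one-dimensional $\mathrm S\mathcal H$-module on which $f\in S(\mathcal Y)$ acts by $f(a_1,\dots,a_n)$ and each $T_i$ acts by $-t^{-1}$. With $[m]_r=(r^m-1)/(r-1)$, $\mathbf e_n=\frac{1}{[n]_{t^{-2}}!}\sum_{w\in\mathfrak S_n}(-t^{-1})^{\ell(w)}T_w$ is the sign idempotent. $\underline{\mathbf a}$ is descending if whenever $i<j$ and $a_i/a_j=t^{2z}$ with $z\in\mathbb Z$, then $z\ge0$. *)

(* Defs.v *)
From HB Require Import structures.
From mathcomp Require Import all_boot all_order all_fingroup all_algebra.
Set Implicit Arguments. Unset Strict Implicit. Unset Printing Implicit Defensive.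
Import Order.TTheory GRing.Theory Num.Theory.
Local Open Scope ring_scope.

(* Conventions: everything is 0-indexed.  T i (i < n-1) is the paper's T_{i+1};
   Y i (i < n) is the paper's Y_{i+1}; Yi i is its inverse Y_{i+1}^{-1}. *)

Section Defs.
Variable K : fieldType.

Definition qint (r : K) (m : nat) : K := \sum_(i < m) r ^+ i.
Definition qfact (r : K) (m : nat) : K := \prod_(1 <= k < m.+1) qint r k.

Definition hecke_rels (t : K) (n : nat) (B : algType K) (T Y Yi : nat -> B) : Prop :=
  [/\ (forall i, (i.+2 < n)%N -> T i * T i.+1 * T i = T i.+1 * T i * T i.+1),
      (forall i j, (i.+1 < n)%N -> (j.+1 < n)%N -> (i.+1 < j)%N || (j.+1 < i)%N ->
         T i * T j = T j * T i),
      (forall i, (i.+1 < n)%N -> (T i - t%:A) * (T i + t^-1%:A) = 0),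
      (forall i j, (i < n)%N -> (j < n)%N -> Y i * Y j = Y j * Y i) &
  [/\
      (forall i, (i < n)%N -> Y i * Yi i = 1 /\ Yi i * Y i = 1),
      (forall i, (i.+1 < n)%N -> T i * Y i * T i = Y i.+1) &
      (forall i j, (i.+1 < n)%N -> (j < n)%N -> j != i -> j != i.+1 ->
         T i * Y j = Y j * T i)]].

Definition alg_morph (A B : algType K) (f : A -> B) : Prop :=
  [/\ forall (k : K) x y, f (k *: x + y) = k *: f x + f y,
      f 1 = 1 &
      forall x y, f (x * y) = f x * f y].

Definition is_affine_hecke (t : K) (n : nat) (H : algType K) (T Y Yi : nat -> H) : Prop :=
  hecke_rels t n T Y Yi /\
  forall (B : algType K) (TB YB YiB : nat -> B), hecke_rels t n TB YB YiB ->
    exists! f : H -> B, alg_morph f /\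
      (forall i, (i.+1 < n)%N -> f (T i) = TB i) /\
      (forall i, (i < n)%N -> f (Y i) = YB i /\ f (Yi i) = YiB i).

Definition is_Hmod (H : algType K) (V : lmodType K) (act : H -> V -> V) : Prop :=
  [/\ forall h (k : K) u v, act h (k *: u + v) = k *: act h u + act h v,
      forall (k : K) h1 h2 v, act (k *: h1 + h2) v = k *: act h1 v + act h2 v,
      forall v, act 1 v = v &
      forall h1 h2 v, act (h1 * h2) v = act h1 (act h2 v)].

Definition is_Hmod_hom (H : algType K) (V W : lmodType K)
    (actV : H -> V -> V) (actW : H -> W -> W) (f : V -> W) : Prop :=
  (forall (k : K) u v, f (k *: u + v) = k *: f u + f v) /\
  (forall h v, f (actV h v) = actW h (f v)).

(* Laurent polynomials in Y_1..Y_n: finite formal sums of c * Y^e, e in Z^n *)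
Definition lpoly (n : nat) := seq (K * {ffun 'I_n -> int}).

Definition lcoef n (f : lpoly n) (e : {ffun 'I_n -> int}) : K :=
  \sum_(p <- f | p.2 == e) p.1.

Definition lsym n (f : lpoly n) : Prop :=
  forall (s : 'S_n) (e : {ffun 'I_n -> int}),
    lcoef f [ffun i => e (s i)] = lcoef f e.

Definition Ypow (H : algType K) (Y Yi : nat -> H) (i : nat) (z : int) : H :=
  match z with Posz k => Y i ^+ k | Negz k => Yi i ^+ k.+1 end.

Definition levalH n (H : algType K) (Y Yi : nat -> H) (f : lpoly n) : H :=
  \sum_(p <- f) p.1 *: \prod_(i < n) Ypow Y Yi i (p.2 i).

Definition levalK n (a : 'I_n -> K) (f : lpoly n) : K :=
  \sum_(p <- f) p.1 * \prod_(i < n) a i ^ (p.2 i).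

Definition descending (t : K) n (a : 'I_n -> K) : Prop :=
  forall (i j : 'I_n) (z : int), (i < j)%N -> a i / a j = t ^ (2 * z) -> 0 <= z.

(* Ind_{K[Y]}^{H(Y)} a, given by its universal property, with v0 = 1 (x) v *)
Definition is_ind_KY n (H : algType K) (Y Yi : nat -> H) (a : 'I_n -> K)
    (V : lmodType K) (act : H -> V -> V) (v0 : V) : Prop :=
  [/\ is_Hmod act,
      (forall f : lpoly n, act (levalH Y Yi f) v0 = levalK a f *: v0) &
      forall (W : lmodType K) (actW : H -> W -> W) (w : W), is_Hmod actW ->
        (forall f : lpoly n, actW (levalH Y Yi f) w = levalK a f *: w) ->
        exists! g : V -> W, is_Hmod_hom act actW g /\ g v0 = w].

(* Ind_{SH}^{H(Y)} ({a} boxtimes sgn), given by its universal property, with u0 = 1 (x) u *)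
Definition is_ind_SH (t : K) n (H : algType K) (T Y Yi : nat -> H) (a : 'I_n -> K)
    (V : lmodType K) (act : H -> V -> V) (u0 : V) : Prop :=
  [/\ is_Hmod act,
      (forall i, (i.+1 < n)%N -> act (T i) u0 = - t^-1 *: u0),
      (forall f : lpoly n, lsym f -> act (levalH Y Yi f) u0 = levalK a f *: u0) &
      forall (W : lmodType K) (actW : H -> W -> W) (w : W), is_Hmod actW ->
        (forall i, (i.+1 < n)%N -> actW (T i) w = - t^-1 *: w) ->
        (forall f : lpoly n, lsym f -> actW (levalH Y Yi f) w = levalK a f *: w) ->
        exists! g : V -> W, is_Hmod_hom act actW g /\ g u0 = w].

End Defs.

(* Reduced words for permutations (one-line notation, 0-indexed). *)
Fixpoint first_descent (s : seq nat) : option nat :=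
  match s with
  | x :: ((y :: _) as s') => if (y < x)%N then Some 0%N else omap S (first_descent s')
  | _ => None
  end.

Definition swap_at (i : nat) (s : seq nat) : seq nat :=
  set_nth 0%N (set_nth 0%N s i (nth 0%N s i.+1)) i.+1 (nth 0%N s i).

(* if s has a descent at i then s = s' s_i with l(s') = l(s) - 1 *)
Fixpoint rword (fuel : nat) (s : seq nat) : seq nat :=
  match fuel with
  | 0 => [::]
  | f.+1 => match first_descent s with
            | None => [::]
            | Some i => rcons (rword f (swap_at i s)) i
            end
  end.

Definition perm_word n (w : 'S_n) : seq nat :=
  rword (n * n) [seq val (w i) | i <- enum 'I_n].

Definition perm_length n (w : 'S_n) : nat :=
  #|[set p : 'I_n * 'I_n | (p.1 < p.2)%N && (w p.2 < w p.1)%N]|.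

Definition Tw (K : fieldType) (H : algType K) (T : nat -> H) n (w : 'S_n) : H :=
  \prod_(i <- perm_word w) T i.

Definition sign_idem (K : fieldType) (t : K) n (H : algType K) (T : nat -> H) : H :=
  (qfact (t ^- 2) n)^-1 *: \sum_(w : 'S_n) (- t^-1) ^+ (perm_length w) *: Tw T w.

(* Main.v *)
Require Import Defs.
From HB Require Import structures.
From mathcomp Require Import all_boot all_order all_fingroup all_algebra.
From mathcomp Require Import zify ring.
Import Order.TTheory GRing.Theory Num.Theory.
Local Open Scope ring_scope.

(** Put [p = t^-2] and let [e] be the unnormalised sign idempotent.
    The inverse map sends [v] to a multiple of [D u] with
    [D = \prod_(i < j) (Y_i - a_j)]; neither induced module needs an explicit basis.

    - [D u] has weight [a], and [e D u = c u] with [c = \prod_(i < j) (a_i - p a_j)].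
      Both go by removing the last strand, using [F_Y = \prod_i (Y_i - X)] and
      [F_a = \prod_i (a_i - X)], which agree coefficientwise on [u].
      With [b = a_n] and [g = \prod_(i < n) (Y_i - b)], the coset sum of [e] turns
      [g u] into the divided difference of [F_Y] between [b] and [p b], applied to [u],
      that is, into [\prod_(i < n) (a_i - p b) u].
    - [D e v = c v].  Here one removes the first strand: writing [e = e' Q] and [X_k]
      for [e'] times the sum of the first [k] terms of [Q v], one finds
      [(Y_1 - a_k) X_k = (Y_1 - p a_k) X_(k-1)].

    Since [a] is descending, [c <> 0]. *)

Set Implicit Arguments.
Unset Strict Implicit.
Unset Printing Implicit Defensive.

(** * First-descent words *)

Lemma first_descent_sorted (s : seq nat) : sorted leq s -> first_descent s = None.
Proof.
elim: s => [|x [|y s] IHs] //= /andP[le_xy /IHs].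
by rewrite ltnNge le_xy /= => ->.
Qed.

Lemma first_descent_cat (s1 s2 : seq nat) (x y : nat) :
  sorted leq (rcons s1 x) -> (y < x)%N ->
  first_descent (s1 ++ x :: y :: s2) = Some (size s1).
Proof.
move=> + lt_yx; elim: s1 => [|z [|z' s1] IHs] /=; first by rewrite lt_yx.
  by case/andP=> le_zx _; rewrite ltnNge le_zx /= lt_yx.
case/andP=> le_zz' /IHs; rewrite ltnNge le_zz' /=.
by move=> ->.
Qed.

Lemma swap_at_cat (s1 s2 : seq nat) (x y : nat) :
  swap_at (size s1) (s1 ++ x :: y :: s2) = s1 ++ y :: x :: s2.
Proof.
rewrite /swap_at; elim: s1 => [|z s1 IHs] //=.
by congr cons; exact: IHs.
Qed.

(* [sorts_by s wd s']: following first descents turns [s] into the sorted [s'],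
   recording the word [wd]; unlike [rword] it carries no fuel. *)
Inductive sorts_by : seq nat -> seq nat -> seq nat -> Prop :=
| SortedBy s : sorted leq s -> sorts_by s [::] s
| SwapBy s1 x y s2 wd s' : sorted leq (rcons s1 x) -> (y < x)%N ->
    sorts_by (s1 ++ y :: x :: s2) wd s' ->
    sorts_by (s1 ++ x :: y :: s2) (rcons wd (size s1)) s'.

(** One unit of fuel is spent per recorded letter, so any fuel at least the length of the word gives
    the same result. *)
Lemma rword_sorts_by s wd s' f : sorts_by s wd s' -> (size wd <= f)%N -> rword f s = wd.
Proof.
move=> sP; elim: sP f => [{}s s_sorted|s1 x y s2 {}wd {}s' s1x lt_yx _ IH] f.
  by case: f => //= f _; rewrite first_descent_sorted.
case: f => [|f]; rewrite size_rcons // ltnS => le_f /=.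
by rewrite first_descent_cat // swap_at_cat IH.
Qed.

(** A last entry [v] lies beyond every descent used on [s], so [s] is sorted first. Earlier swaps
    stand further right in the recorded word, hence the order [wd2 ++ wd]. *)
Lemma sorts_by_rcons s wd s' v wd2 s2 :
  sorts_by s wd s' -> sorts_by (rcons s' v) wd2 s2 ->
  sorts_by (rcons s v) (wd2 ++ wd) s2.
Proof.
elim=> [{}s _|s1 x y s3 {}wd {}s' s1x lt_yx _ IH] s2P; first by rewrite cats0.
rewrite -rcons_cat rcons_cat /=; apply: SwapBy => //.
by have := IH s2P; rewrite rcons_cat.
Qed.

Lemma sorts_by_map (g : nat -> nat) s wd s' : {mono g : x y / (x <= y)%N} ->
  sorts_by s wd s' -> sorts_by (map g s) wd (map g s').
Proof.
move=> g_mono; have mapS r : sorted leq r -> sorted leq (map g r).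
  by rewrite sorted_map; apply: sub_sorted => x y; rewrite /= g_mono.
elim=> [{}s /mapS|s1 x y s2 {}wd {}s' s1x lt_yx _]; first exact: SortedBy.
rewrite !map_cat /= -(size_map g s1) => IH; apply: SwapBy => //.
  by rewrite -map_rcons; exact: mapS.
by rewrite ltnNge g_mono -ltnNge.
Qed.

(** The entry [v] moves left across [s2] one place at a time; what precedes it stays sorted, so each
    swap is at the first descent. The positions decrease, and the word read from the left is an
    increasing run. *)
Lemma sorts_by_insert (s1 s2 s3 : seq nat) v :
  sorted leq (s1 ++ v :: s2 ++ s3) -> all (ltn v) s2 ->
  sorts_by (s1 ++ s2 ++ v :: s3) (iota (size s1) (size s2)) (s1 ++ v :: s2 ++ s3).
Proof.
elim/last_ind: s2 s3 => [|s2 x IH] s3; first by move=> sP _; exact: SortedBy.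
rewrite !cat_rcons all_rcons size_rcons => sP /andP[lt_vx v_s2].
rewrite -addn1 iotaD /= cats1 -size_cat catA; apply: SwapBy => //.
  apply: (subseq_sorted leq_trans) sP; rewrite -cats1 -catA cat_subseq //.
  apply: (subseq_trans _ (subseq_cons _ v)).
  by rewrite cat_subseq // sub1seq mem_head.
by rewrite -catA; apply: IH.
Qed.

Lemma map_bump_iota (j n : nat) : (j <= n)%N ->
  map (bump j) (iota 0 n) = iota 0 j ++ iota j.+1 (n - j).
Proof.
move=> le_jn; rewrite -{1}(subnKC le_jn) iotaD add0n map_cat; congr (_ ++ _).
  rewrite -[RHS]map_id; apply/eq_in_map => i; rewrite mem_iota => /andP[_ lt_ij].
  by rewrite /bump leqNgt lt_ij.
rewrite -[in RHS]add1n iotaDl; apply/eq_in_map => i; rewrite mem_iota => /andP[le_ji _].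
by rewrite /bump le_ji.
Qed.

(** In one-line notation [lift_perm ord_max j s] is [s] with its values bumped past [j], followed by
    [j]. First [wd] sorts the initial [n] entries, then [j] moves left to its place. *)
Lemma sorts_by_lift_perm n (j : 'I_n.+1) (s : 'S_n) wd :
  sorts_by [seq val (s i) | i <- enum 'I_n] wd (iota 0 n) ->
  sorts_by [seq val (lift_perm ord_max j s i) | i <- enum 'I_n.+1]
    (iota j (n - j) ++ wd) (iota 0 n.+1).
Proof.
move=> sP.
have -> : [seq val (lift_perm ord_max j s i) | i <- enum 'I_n.+1]
    = rcons (map (bump j) [seq val (s i) | i <- enum 'I_n]) j.
  rewrite enum_ordSr map_rcons lift_perm_id -!map_comp; congr rcons.
  apply: eq_map => i /=; have -> : widen_ord (leqnSn n) i = lift ord_max i.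
    by apply: val_inj; rewrite /= /bump leqNgt ltn_ord.
  by rewrite lift_perm_lift.
have bumpM : {mono bump j : x y / (x <= y)%N} by move=> x y; rewrite leq_bump2.
apply: sorts_by_rcons (sorts_by_map bumpM sP) _.
have le_jn : (j <= n)%N by rewrite -ltnS.
rewrite map_bump_iota // -cats1 -catA.
have e1 : iota 0 n.+1 = iota 0 j ++ nat_of_ord j :: iota j.+1 (n - j) ++ [::].
  by rewrite cats0 -[_ :: _]/(iota j (n - j).+1) -iotaD -subSn // subnKC // ltnW.
have := @sorts_by_insert (iota 0 j) (iota j.+1 (n - j)) [::] j.
rewrite -e1 !size_iota; apply; first exact: iota_sorted.
by apply/allP=> i; rewrite mem_iota => /andP[].
Qed.

(** The last position is inverted exactly with the [n - j] larger values; all other inversions are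
    those of [s]. *)
Lemma perm_length_lift_perm n (j : 'I_n.+1) (s : 'S_n) :
  perm_length (lift_perm ord_max j s) = (n - j + perm_length s)%N.
Proof.
have lenE m (w : 'S_m) : perm_length w =
    (\sum_(q < m) \sum_(p < m) ((p < q) && (w q < w p)))%N.
  rewrite exchange_big pair_big /= /perm_length -sum1_card big_mkcond /=.
  by apply: eq_bigr => -[p q] _; rewrite inE /=; case: (_ && _).
have wE i : widen_ord (leqnSn n) i = lift ord_max i.
  by apply: val_inj; rewrite /= /bump leqNgt ltn_ord.
rewrite !lenE big_ord_recr /= addnC; congr (_ + _)%N.
  rewrite big_ord_recr /= ltnn addn0 lift_perm_id.
  under eq_bigr => i _ do rewrite wE lift_perm_lift ltn_ord /=.
  rewrite (reindex_inj (@perm_inj _ s^-1)) /=.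
  under eq_bigr => i _ do rewrite permKV.
  rewrite -(big_mkord xpredT (fun i => (j < bump j i) : nat)).
  have le_jn : (j <= n)%N by rewrite -ltnS.
  rewrite (@big_cat_nat _ _ _ j) //= big1_seq ?add0n.
    rewrite big_nat (eq_bigr (fun=> 1%N)); last first.
      by move=> i /andP[le_ji _]; rewrite /bump le_ji add1n ltnS le_ji.
    by rewrite -big_nat sum_nat_const_nat muln1.
  move=> i /=; rewrite mem_index_iota => /andP[_ lt_ij].
  by rewrite /bump (leqNgt j i) lt_ij add0n ltnNge ltnW.
apply: eq_bigr => q _; rewrite big_ord_recr /= ltnNge (ltnW (ltn_ord q)) /= addn0.
apply: eq_bigr => p _; rewrite !wE !lift_perm_lift /= !ltnNge.
by rewrite leq_bump2.
Qed.

Lemma lift_perm_max_bij n :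
  bijective (fun js : 'I_n.+1 * 'S_n => lift_perm ord_max js.1 js.2).
Proof.
apply: inj_card_bij => [[j s] [j' s'] /= /permP eq_js|].
  have := eq_js ord_max; rewrite !lift_perm_id => ejj'; subst j'.
  congr pair; apply/permP => k; have := eq_js (lift ord_max k).
  by rewrite !lift_perm_lift => /lift_inj.
by rewrite card_prod !card_Sn card_ord factS.
Qed.

(** The length is carried along the induction because it counts inversions: it is at most [n * n],
    the fuel given to [rword]. *)
Lemma sorts_by_perm_word n (w : 'S_n) :
  sorts_by [seq val (w i) | i <- enum 'I_n] (perm_word w) (iota 0 n) /\
  size (perm_word w) = perm_length w.
Proof.
suff [wd [sP wd_size]] : exists wd,
    sorts_by [seq val (w i) | i <- enum 'I_n] wd (iota 0 n) /\ size wd = perm_length w.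
  have wd_le : (size wd <= n * n)%N.
    by rewrite wd_size (leq_trans (max_card _)) // card_prod card_ord.
  by rewrite /perm_word (rword_sorts_by sP wd_le).
elim: n w => [|n IHn] w.
  exists [::]; split.
    have -> : [seq val (w i) | i <- enum 'I_0] = [::].
      by apply/size0nil; rewrite size_map size_enum_ord.
    exact: SortedBy.
  by apply/esym/eqP; rewrite cards_eq0; apply/eqP/setP => -[[]].
have [g _ gK] := lift_perm_max_bij n.
rewrite -(gK w); case: (g w) => j s /=; have [wd [sP wd_size]] := IHn s.
exists (iota j (n - j) ++ wd); split; first exact: sorts_by_lift_perm.
by rewrite perm_length_lift_perm size_cat size_iota wd_size.
Qed.

Lemma perm_word_lift_perm n (j : 'I_n.+1) (s : 'S_n) :
  perm_word (lift_perm ord_max j s) = iota j (n - j) ++ perm_word s.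
Proof.
have [sP sz_s] := sorts_by_perm_word s.
apply: (rword_sorts_by (sorts_by_lift_perm j sP)).
rewrite size_cat size_iota sz_s -perm_length_lift_perm.
by rewrite (leq_trans (max_card _)) // card_prod card_ord.
Qed.

Lemma sum_lift_perm (V : nmodType) n (F : 'S_n.+1 -> V) :
  \sum_w F w = \sum_j \sum_s F (lift_perm ord_max j s).
Proof. by rewrite pair_big (reindex _ (onW_bij _ (lift_perm_max_bij n))). Qed.

(** * Sign sums in the finite Hecke algebra *)

Section HeckeSigns.
Variables (K : fieldType) (t : K) (H : algType K).
Implicit Types T : nat -> H.

Definition sgn_sum n T : H :=
  \sum_(w : 'S_n) (- t^-1) ^+ perm_length w *: Tw T w.

(* With [m] strands the sums [up_sum m.-1] and [down_sum m] run over the minimal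
   representatives of the cosets of the first (resp. last) [m.-1] strands. *)
Definition up_sum n T : H :=
  \sum_(0 <= j < n.+1) (- t^-1) ^+ (n - j) *: \prod_(j <= i < n) T i.

Definition down_sum n T : H :=
  \sum_(0 <= k < n) (- t^-1) ^+ k *: \prod_(i < k) T i.

(** A second form of [sgn_sum], splitting off the first strand instead of the last: [T \o succn]
    generates the algebra on the remaining strands. The two are identified in [sgn_prodE]. *)
Fixpoint sgn_prod n T : H :=
  if n is m.+1 then sgn_prod m (T \o succn) * down_sum n T else 1.

Definition left_sgn n T (y : H) := forall i, (i.+1 < n)%N -> T i * y = - t^-1 *: y.
Definition right_sgn n T (x : H) := forall i, (i.+1 < n)%N -> x * T i = - t^-1 *: x.

Lemma sgn_sum0 T : sgn_sum 0 T = 1.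
Proof.
rewrite /sgn_sum (eq_bigr (fun=> 1)) => [|w _].
  by rewrite sumr_const card_Sn.
have [_] := sorts_by_perm_word w.
by rewrite /Tw => <-; rewrite /perm_word /= big_nil scale1r.
Qed.

(** Factorisation along the cosets of the first [n] strands: for [lift_perm ord_max j s] words
    concatenate and lengths add. *)
Lemma sgn_sumS n T : sgn_sum n.+1 T = up_sum n T * sgn_sum n T.
Proof.
rewrite /sgn_sum sum_lift_perm /up_sum big_mkord mulr_suml; apply: eq_bigr => j _.
rewrite mulr_sumr; apply: eq_bigr => s _.
rewrite perm_length_lift_perm /Tw perm_word_lift_perm big_cat exprD /=.
by rewrite -scalerAl -scalerAr scalerA.
Qed.
Lemma sum_nat_two (V : nmodType) (F : nat -> V) n i : (i.+1 < n)%N ->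
  (forall j, (j < n)%N -> j != i -> j != i.+1 -> F j = 0) ->
  \sum_(0 <= j < n) F j = F i + F i.+1.
Proof.
move=> lt_in F0; rewrite (@big_cat_nat _ _ _ i) //=; last exact: ltnW (ltnW _).
rewrite big_nat big1 ?add0r => [|j /andP[_ lt_ji]]; last first.
  by apply: F0; lia.
rewrite big_ltn ?(ltnW lt_in) // big_ltn // addrA [X in _ + X]big_nat big1 ?addr0 //.
by move=> j /andP[lt_ij lt_jn]; apply: F0; lia.
Qed.

(** The quadratic relation is in expanded form, ready for rewriting. *)
Definition finite_hecke n T : Prop :=
  [/\ forall i, (i.+2 < n)%N -> T i * T i.+1 * T i = T i.+1 * T i * T i.+1,
      forall i j, (i.+1 < n)%N -> (j.+1 < n)%N -> (i.+1 < j)%N || (j.+1 < i)%N ->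
        T i * T j = T j * T i &
      forall i, (i.+1 < n)%N -> T i * T i = 1 + (t - t^-1) *: T i].

Lemma finite_hecke_widen n T : finite_hecke n.+1 T -> finite_hecke n T.
Proof.
by case=> braidT commT quadT; split=> [i lt_i|i j lt_i lt_j|i lt_i];
  [apply: braidT | apply: commT | apply: quadT]; apply: leqW.
Qed.

Lemma finite_hecke_shift n T : finite_hecke n.+1 T -> finite_hecke n (T \o succn).
Proof.
by case=> braidT commT quadT; split=> [i ?|i j ? ? ?|i ?] /=;
  [rewrite braidT | rewrite commT | rewrite quadT] => //; lia.
Qed.

Lemma comm_sgn_prod n T (x : H) : (forall i, (i.+1 < n)%N -> GRing.comm x (T i)) ->
  GRing.comm x (sgn_prod n T).
Proof.
elim: n T => [|n IHn] T xT /=; first exact: commr1.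
apply: commrM; first by apply: IHn => i ? /=; exact: xT.
rewrite /down_sum big_nat; apply: commr_sum => k ?.
rewrite /GRing.comm -scalerAr -scalerAl; congr (_ *: _); apply: commr_prod => i _.
by apply: xT; have := ltn_ord i; lia.
Qed.

Hypothesis t0 : t != 0.

Lemma comm_prod_nat (R : pzSemiRingType) (x : R) (F : nat -> R) j k :
  (forall i, (j <= i < k)%N -> GRing.comm x (F i)) ->
  GRing.comm x (\prod_(j <= i < k) F i).
Proof. by move=> xF; rewrite big_nat; apply: commr_prod. Qed.

(** With [A] standing for [T i * B] or [B * T i], this says that [B - t^-1 *: A] is a sign
    eigenvector, so it serves both sides at once. *)
Lemma quad_sgn_scalars (V : lmodType K) (A B : V) :
  A - t^-1 *: (B + (t - t^-1) *: A) = - t^-1 *: (B - t^-1 *: A).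
Proof.
rewrite scalerDr opprD addrA scalerBr !scalerA scaleNr mulNr scaleNr opprK.
rewrite addrAC addrC; congr (_ + _).
by rewrite mulrBr mulVf // scalerBl scale1r opprB addrC subrK.
Qed.

Lemma left_sgn_quad n T i (B : H) : finite_hecke n T -> (i.+1 < n)%N ->
  T i * (B - t^-1 *: (T i * B)) = - t^-1 *: (B - t^-1 *: (T i * B)).
Proof.
case=> _ _ quadT lt_in; rewrite mulrBr -scalerAr mulrA quadT // mulrDl mul1r -scalerAl.
exact: quad_sgn_scalars.
Qed.

Lemma right_sgn_quad n T i (B : H) : finite_hecke n T -> (i.+1 < n)%N ->
  (B - t^-1 *: (B * T i)) * T i = - t^-1 *: (B - t^-1 *: (B * T i)).
Proof.
case=> _ _ quadT lt_in; rewrite mulrBl -scalerAl -mulrA quadT // mulrDr mulr1 -scalerAr.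
exact: quad_sgn_scalars.
Qed.

(** [T i] passes the letters below [i.-1], one braid move at the letters [i.-1], [i] turns it into
    [T i.-1], and this passes the rest. *)
Lemma up_word_braid n T i j : finite_hecke n.+1 T -> (j < i < n)%N ->
  T i * \prod_(j <= k < n) T k = \prod_(j <= k < n) T k * T i.-1.
Proof.
case=> braidT commT _ /andP[lt_ji lt_in]; case: i lt_ji lt_in => // i lt_ji lt_in /=.
have -> : \prod_(j <= k < n) T k
    = \prod_(j <= k < i) T k * (T i * T i.+1) * \prod_(i.+2 <= k < n) T k.
  rewrite (@big_cat_nat _ _ _ i) //=; last lia.
  by rewrite (@big_ltn _ _ _ i) ?(ltnW lt_in) // (@big_ltn _ _ _ i.+1) // !mulrA.
rewrite !mulrA (comm_prod_nat (x := T i.+1)); last first.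
  by move=> k /andP[_ lt_ki]; rewrite /GRing.comm commT //; lia.
have braidr x : x * T i.+1 * T i * T i.+1 = x * T i * T i.+1 * T i.
  by rewrite -!mulrA !(mulrA (T _)) braidT.
rewrite braidr -!mulrA; do 3!congr (_ * _); apply: comm_prod_nat => k /andP[lt_ik lt_kn].
by rewrite /GRing.comm commT //; lia.
Qed.

(** Each term other than [j = i] and [j = i.+1] is an eigenvector by itself: [T i] crosses its word,
    unchanged or as [T i.-1], and is absorbed by [y]. The two remaining terms combine to a multiple
    of [B - t^-1 *: (T i * B)], which the quadratic relation settles. *)
Lemma up_sum_left_sgn n T y : finite_hecke n.+1 T -> left_sgn n T y ->
  left_sgn n.+1 T (up_sum n T * y).
Proof.
move=> heckeT yT i; rewrite ltnS => lt_in; have [braidT commT quadT] := heckeT.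
apply/eqP; rewrite -subr_eq0 /up_sum mulr_suml mulr_sumr scaler_sumr -sumrB.
pose B := \prod_(i.+1 <= k < n) T k * y; apply/eqP.
rewrite (@sum_nat_two _ _ _ i) //; last first.
  move=> j lt_jn neq_ji neq_jiS; rewrite -scalerAl -scalerAr scalerA mulrC -scalerA.
  rewrite -scalerBr mulrA; apply/eqP; rewrite scaler_eq0 subr_eq0; apply/orP; right.
  case: (ltnP i j) => [lt_ij|le_ji].
    rewrite (comm_prod_nat (x := T i)) -?mulrA ?yT -?scalerAr //; first lia.
    by move=> k ?; rewrite /GRing.comm commT //; lia.
  have lt_ji : (j < i < n)%N by lia.
  by rewrite up_word_braid // -mulrA yT -?scalerAr //; lia.
rewrite addrACA -opprD -scalerDr -mulrDr.
have -> : \prod_(i <= k < n) T k = T i * \prod_(i.+1 <= k < n) T k by rewrite big_ltn.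
have -> : (n - i)%N = (n - i.+1).+1 by lia.
rewrite exprSr -scalerA -!scalerAl -scalerDr -mulrA -/B scaleNr (addrC _ B) -scalerAr.
by rewrite (left_sgn_quad B heckeT) // !scalerA [_ ^+ _ * _]mulrC subrr.
Qed.

Lemma down_word_braid n T i k : finite_hecke n T -> (i.+1 < k)%N -> (k < n)%N ->
  \prod_(j < k) T j * T i = T i.+1 * \prod_(j < k) T j.
Proof.
case=> braidT commT _ lt_ik lt_kn; rewrite -(big_mkord xpredT T).
have -> : \prod_(0 <= j < k) T j
    = \prod_(0 <= j < i) T j * (T i * T i.+1) * \prod_(i.+2 <= j < k) T j.
  rewrite (@big_cat_nat _ _ _ i) //=; last lia.
  by rewrite (@big_ltn _ _ _ i) ?(ltnW lt_ik) // (@big_ltn _ _ _ i.+1) // !mulrA.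
rewrite !mulrA (comm_prod_nat (x := T i.+1)); last first.
  by move=> j /andP[_ lt_ji]; rewrite /GRing.comm commT //; lia.
have braidr x : x * T i * T i.+1 * T i = x * T i.+1 * T i * T i.+1.
  by rewrite -!mulrA !(mulrA (T _)) braidT //; lia.
rewrite -braidr -mulrA -(@comm_prod_nat _ (T i) T i.+2 k) ?mulrA // => j /andP[lt_ij lt_jk].
by rewrite /GRing.comm commT //; lia.
Qed.

(** Mirror image of [up_sum_left_sgn]: outside [k = i] and [k = i.+1] the letter [T i] crosses the
    word, unchanged or as [T i.+1], and [x] absorbs it. *)
Lemma down_sum_right_sgn n T x : finite_hecke n T ->
  (forall i, (i.+2 < n)%N -> x * T i.+1 = - t^-1 *: x) ->
  right_sgn n T (x * down_sum n T).
Proof.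
move=> heckeT xT i lt_in; have [braidT commT quadT] := heckeT.
apply/eqP; rewrite -subr_eq0 /down_sum mulr_sumr mulr_suml scaler_sumr -sumrB.
pose B := x * \prod_(j < i) T j; apply/eqP.
rewrite (@sum_nat_two _ _ _ i) //; last first.
  move=> k lt_kn neq_ki neq_kiS; rewrite -scalerAr -scalerAl scalerA mulrC -scalerA.
  rewrite -scalerBr -mulrA; apply/eqP; rewrite scaler_eq0 subr_eq0; apply/orP; right.
  case: (ltnP i k) => [lt_ik|le_ki].
    have {}lt_ik : (i.+1 < k)%N by lia.
    by rewrite (down_word_braid heckeT) // mulrA ?xT -?scalerAl //; lia.
  rewrite -(big_mkord xpredT T) -(comm_prod_nat (x := T i)) ?mulrA; last first.
    by move=> j ?; rewrite /GRing.comm commT //; lia.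
  (* [x] is not assumed to absorb [T 0], but [i = 0] would force [k = 0 = i]. *)
  case: i {B} lt_in neq_ki neq_kiS le_ki => [|i] *; first lia.
  by rewrite xT -?scalerAl //; lia.
rewrite addrACA -opprD -scalerDr -mulrDl big_ord_recr /=.
rewrite exprSr -scalerA -!scalerAr -scalerDr mulrA -/B scaleNr -scalerAl.
by rewrite (right_sgn_quad B heckeT) // !scalerA [_ ^+ _ * _]mulrC subrr.
Qed.

Lemma sgn_prod_right_sgn n T : finite_hecke n T -> right_sgn n T (sgn_prod n T).
Proof.
elim: n T => [|n IHn] T heckeT //=; apply: down_sum_right_sgn => // i lt_in.
exact: (IHn _ (finite_hecke_shift heckeT)).
Qed.

Lemma sgn_sum_left_sgn n T : finite_hecke n T -> left_sgn n T (sgn_sum n T).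
Proof.
elim: n T => [|n IHn] T heckeT //; rewrite sgn_sumS; apply: up_sum_left_sgn => //.
exact/IHn/finite_hecke_widen.
Qed.

Lemma mul_prod_sgn T (x : H) j n : (forall i, (j <= i < n)%N -> x * T i = - t^-1 *: x) ->
  x * \prod_(j <= i < n) T i = (- t^-1) ^+ (n - j) *: x.
Proof.
elim: n => [|n IHn] xT; first by rewrite big_geq // mulr1 scale1r.
have [le_jn|lt_nj] := leqP j n; last first.
  rewrite big_geq // mulr1.
  by have /eqP -> : (n.+1 - j == 0)%N; rewrite ?subn_eq0 // scale1r.
rewrite big_nat_recr //= mulrA IHn => [|i ?]; last by apply: xT; lia.
by rewrite -scalerAl xT ?leqnn ?andbT // scalerA -exprSr subSn.
Qed.

Lemma prod_mul_sgn T (y : H) n : (forall i, (i < n)%N -> T i * y = - t^-1 *: y) ->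
  \prod_(i < n) T i * y = (- t^-1) ^+ n *: y.
Proof.
elim: n => [|n IHn] yT; first by rewrite big_ord0 mul1r scale1r.
rewrite big_ord_recr /= -mulrA yT // -scalerAr IHn => [|i ?]; last by apply: yT; lia.
by rewrite scalerA -exprS.
Qed.

(** Under the sign character a coset representative of length [k] contributes its sign twice, as
    coefficient and as eigenvalue. *)
Lemma qint_sgn n : \sum_(k < n) (- t^-1) ^+ k * (- t^-1) ^+ k = qint (t ^- 2) n.
Proof. by apply: eq_bigr => k _; rewrite -exprMn mulrNN -exprVn expr2. Qed.

Lemma qfactS r n : qfact r n.+1 = qfact r n * qint r n.+1 :> K.
Proof. by rewrite /qfact big_nat_recr. Qed.

Lemma right_sgn_mul_sum n T x : right_sgn n T x ->
  x * sgn_sum n T = qfact (t ^- 2) n *: x.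
Proof.
elim: n => [|n IHn] xT; first by rewrite sgn_sum0 mulr1 /qfact big_geq // scale1r.
have xT' : right_sgn n T x by move=> i ?; apply: xT; lia.
rewrite sgn_sumS mulrA; have -> : x * up_sum n T = qint (t ^- 2) n.+1 *: x.
  rewrite /up_sum mulr_sumr -qint_sgn scaler_suml big_mkord.
  rewrite [RHS](reindex_inj rev_ord_inj) /=.
  apply: eq_bigr => j _; rewrite -scalerAr mul_prod_sgn ?scalerA ?subSS // => i ?.
  by apply: xT; lia.
by rewrite -scalerAl IHn // scalerA mulrC -qfactS.
Qed.

Lemma prod_mul_left_sgn n T y : left_sgn n T y ->
  sgn_prod n T * y = qfact (t ^- 2) n *: y.
Proof.
elim: n T => [|n IHn] T yT /=; first by rewrite mul1r /qfact big_geq // scale1r.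
have yT' : left_sgn n (T \o succn) y by move=> i ?; apply: yT; lia.
rewrite -mulrA; have -> : down_sum n.+1 T * y = qint (t ^- 2) n.+1 *: y.
  rewrite /down_sum mulr_suml -qint_sgn scaler_suml big_mkord.
  apply: eq_bigr => j _; rewrite -scalerAl prod_mul_sgn ?scalerA // => i ?.
  by apply: yT; have := ltn_ord j; lia.
by rewrite -scalerAr IHn // scalerA mulrC -qfactS.
Qed.

(* In [sgn_prod * sgn_sum] either factor evaluates the other under the sign character. *)
Lemma sgn_prodE n T : finite_hecke n T -> qfact (t ^- 2) n != 0 ->
  sgn_prod n T = sgn_sum n T.
Proof.
move=> heckeT qn0; apply: (scalerI qn0).
rewrite -(right_sgn_mul_sum (sgn_prod_right_sgn heckeT)).
by rewrite (prod_mul_left_sgn (sgn_sum_left_sgn heckeT)).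
Qed.

End HeckeSigns.

(** * Affine relations *)

Section AffineRelations.
Variables (K : fieldType) (t : K) (H : algType K).
Implicit Types T Y Yi : nat -> H.

Lemma hecke_rels_widen n T Y Yi : hecke_rels t n.+1 T Y Yi -> hecke_rels t n T Y Yi.
Proof.
case=> braidT commT quadT commY [invY TYT TY].
split; [| | | |split]; move=> *; first [apply: braidT | apply: commT | apply: quadT
  | apply: commY | apply: invY | apply: TYT | apply: TY] => //; lia.
Qed.

Lemma hecke_rels_shift n T Y Yi : hecke_rels t n.+1 T Y Yi ->
  hecke_rels t n (T \o succn) (Y \o succn) (Yi \o succn).
Proof.
case=> braidT commT quadT commY [invY TYT TY].
split; [| | | |split]; move=> * /=; [exact: braidT | exact: commT | exact: quadT
  | exact: commY | exact: invY | exact: TYT | exact: TY].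
Qed.

Hypothesis t0 : t != 0.

Lemma hecke_rels_finite n T Y Yi : hecke_rels t n T Y Yi -> finite_hecke t n T.
Proof.
case=> braidT commT quadT _ _; split=> // i /quadT.
rewrite mulrBl !mulrDr -!scalerAl -!scalerAr !mul1r mulr1 !scalerA divff // scale1r.
move=> /eqP; rewrite subr_eq0 => /eqP eqT; apply: (addIr (t^-1 *: T i)).
by rewrite eqT scalerBl -addrA subrK addrC.
Qed.

Section Relations.
Variables (n : nat) (T Y Yi : nat -> H).
Hypothesis heckeTY : hecke_rels t n T Y Yi.

(** The explicit inverse of [T i] lets the relation between [Y i] and [Y i.+1] be solved for
    [Y i * T i] and for [T i * Y i]. *)
Lemma T_sub_inv i : (i.+1 < n)%N ->
  (T i - (t - t^-1)%:A) * T i = 1 /\ T i * (T i - (t - t^-1)%:A) = 1.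
Proof.
move=> lt_in; have [_ _ quadT] := hecke_rels_finite heckeTY.
by rewrite mulrBl mulrBr -scalerAl -scalerAr mul1r mulr1 quadT // addrK.
Qed.

Lemma YT i : (i.+1 < n)%N -> Y i * T i = (T i - (t - t^-1)%:A) * Y i.+1.
Proof.
move=> lt_in; have [_ _ _ _ [_ TYT _]] := heckeTY.
by rewrite -TYT // !mulrA (T_sub_inv lt_in).1 mul1r.
Qed.

Lemma TY i : (i.+1 < n)%N -> T i * Y i = Y i.+1 * (T i - (t - t^-1)%:A).
Proof.
move=> lt_in; have [_ _ _ _ [_ TYT _]] := heckeTY.
by rewrite -TYT // -!mulrA (T_sub_inv lt_in).2 mulr1.
Qed.

(** Moving [T i] across [Y i] from either side leaves the same correction, a multiple of
    [Y i.+1]. *)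
Lemma T_comm_YD i : (i.+1 < n)%N -> GRing.comm (T i) (Y i + Y i.+1).
Proof.
move=> lt_in; rewrite /GRing.comm mulrDr mulrDl TY // YT // mulrBr mulrBl.
by rewrite -scalerAl -scalerAr mul1r mulr1 addrAC [RHS]addrC addrA.
Qed.

Lemma T_comm_YM i : (i.+1 < n)%N -> GRing.comm (T i) (Y i * Y i.+1).
Proof.
move=> lt_in; have [_ _ _ commY [_ TYT _]] := heckeTY.
rewrite /GRing.comm [in RHS]commY //; last exact: ltnW.
by rewrite -TYT // !mulrA.
Qed.

End Relations.

(* This is the identity [Y_1 z_k = a_k (z_k + (1 - t^-2) (z_1 + ... + z_(k-1)))]
   for [z_k = (- t^-1)^(k-1) x T_1 ... T_(k-1) v] and [v] of weight [a]. *)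
Lemma Y0_down_word n T Y Yi x k : hecke_rels t n T Y Yi ->
  (forall i, (i.+2 < n)%N -> x * T i.+1 = - t^-1 *: x) -> (k < n)%N ->
  (- t^-1) ^+ k *: (x * Y 0%N * \prod_(i < k) T i)
  = x * (down_sum t k.+1 T - t ^- 2 *: down_sum t k T) * Y k.
Proof.
move=> heckeTY xT; have [braidT commT quadT] := hecke_rels_finite heckeTY.
have downS m : down_sum t m.+1 T =
    down_sum t m T + (- t^-1) ^+ m *: \prod_(i < m) T i.
  by rewrite /down_sum big_nat_recr.
elim: k => [|k IHk] lt_kn.
  by rewrite downS /down_sum !big_geq // !big_ord0 !scale1r scaler0 subr0 add0r !mulr1.
have {IHk} IHk := IHk (ltnW lt_kn).
rewrite big_ord_recr /= mulrA exprS -scalerA scalerAl IHk -(mulrA _ (Y k)) (YT heckeTY) //.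
rewrite mulrA scalerAl; congr (_ * _).
have xdownT : x * down_sum t k T * T k = - t^-1 *: (x * down_sum t k T).
  (* For [k = 0] the sum is empty; for larger [k] the letter [T k] commutes with all its words and
     is absorbed by [x]. *)
  case: k lt_kn {IHk} => [|k] lt_kn.
    by rewrite /down_sum big_geq // mulr0 mul0r scaler0.
  have cT : GRing.comm (T k.+1) (down_sum t k.+1 T).
    rewrite /down_sum big_nat; apply: commr_sum => i lt_ik.
    rewrite /GRing.comm -scalerAr -scalerAl; congr (_ *: _).
    rewrite -(big_mkord xpredT T); apply: comm_prod_nat => j ?.
    by rewrite /GRing.comm commT //; lia.
  by rewrite -mulrA -cT mulrA xT // -scalerAl.
set D := down_sum t k T in xdownT downS *; set U := \prod_(i < k) T i.
have Dsub V : D + V - t ^- 2 *: D = (1 - t ^- 2) *: D + V.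
  by rewrite scalerBl scale1r addrAC.
have -> : down_sum t k.+2 T - t ^- 2 *: down_sum t k.+1 T = (1 - t ^- 2) *: D
    + ((1 - t ^- 2) * (- t^-1) ^+ k) *: U + (- t^-1) ^+ k.+1 *: (U * T k).
  rewrite !downS big_ord_recr /= -/D -/U addrAC scalerDr opprD addrACA scalerA.
  by rewrite mulrBl !scalerBl scale1r mul1r.
rewrite downS -/D -/U Dsub !(mulrDr x) -!scalerAr mulrDl -!scalerAl.
rewrite !mulrBr xdownT -!scalerAr !mulr1 (mulrA x).
(* Both sides are now combinations of [A], [B] and [C], and only scalar coefficients remain to be
   compared. *)
set A := x * D; set B := x * U; set C := B * T k.
rewrite -scalerBl !scalerDr !scalerA !scalerN !scalerA -!addrA; congr (_ *: _ + _).
  by field.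
rewrite addrC -exprS; congr (_ + _); rewrite -scaleNr; congr (_ *: _).
by rewrite exprS; move: ((- t^-1) ^+ k) => e; field.
Qed.
End AffineRelations.

(** * The weight vector of the principal series *)

(* [delta n y d] is the product of the [y i - d j] over [i < j < n]. *)
Fixpoint delta (R : pzRingType) n (y d : nat -> R) : R :=
  if n is m.+1 then delta m y d * \prod_(i < m) (y i - d m) else 1.

(** [delta] splits off the last index, as the argument for [u] requires; this version splits off the
    first, as the argument for [v] requires. The factors commute and may be regrouped. *)
Lemma delta_recl (R : pzRingType) n (y d : nat -> R) :
  (forall i j, (i < n.+1)%N -> (j < n.+1)%N -> GRing.comm (y i) (y j)) ->
  (forall i x, GRing.comm (d i) x) ->
  delta n.+1 y d =
    delta n (y \o succn) (d \o succn) * \prod_(1 <= k < n.+1) (y 0%N - d k).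
Proof.
move=> ycomm dcomm; have factor_comm i j k l : (i < n.+1)%N -> (j < n.+1)%N ->
    GRing.comm (y i - d k) (y j - d l).
  move=> lt_in lt_jn; apply: commrB; last exact: commr_sym.
  by apply: commr_sym; apply: commrB; [exact: ycomm | exact: commr_sym].
elim: n ycomm factor_comm => [|n IHn] ycomm factor_comm.
  by rewrite /= big_ord0 big_geq.
rewrite [LHS]/= -/(delta n.+1 y d) IHn; last 2 first.
- by move=> *; apply: ycomm; apply: leqW.
- by move=> *; apply: factor_comm; apply: leqW.
rewrite big_ord_recl (@big_nat_recr _ _ _ n.+1) //= -!mulrA; congr (_ * _).
set P := \prod_(_ <= _ < _) _; set Q := \prod_(i < n) _.
rewrite [LHS]mulrA; apply: commr_prod => i _; apply: commr_sym.
have lt_i : (bump 0 i < n.+2)%N by have := ltn_ord i; rewrite /bump; lia.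
by apply: commrM; [apply: commr_prod => k _|]; exact: factor_comm.
Qed.

Lemma delta_neq0 (F : fieldType) n (y d : nat -> F) :
  (forall i j, (i < j)%N -> (j < n)%N -> y i != d j) -> delta n y d != 0.
Proof.
elim: n => [|n IHn] neq_yd /=; first exact: oner_neq0.
rewrite mulf_neq0 //; first by apply: IHn => i j ? ?; apply: neq_yd => //; apply: leqW.
by apply/prodf_neq0 => i _; rewrite subr_eq0 neq_yd.
Qed.

Lemma comm_delta (R : pzRingType) n (y d : nat -> R) x :
  (forall i, (i < n)%N -> GRing.comm x (y i)) -> (forall i z, GRing.comm (d i) z) ->
  GRing.comm x (delta n y d).
Proof.
elim: n => [|n IHn] xy dcomm; first exact: commr1.
apply: commrM; first by apply: IHn => // i ?; apply: xy; apply: leqW.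
apply: commr_prod => i _; apply: commrB; last exact: commr_sym.
by apply: xy; apply: ltnW; rewrite ltnS.
Qed.

(** * Linear rules for the action on a module *)

Section Action.
Variables (K : fieldType) (H : algType K) (V : lmodType K) (act : H -> V -> V).
Hypothesis actP : is_Hmod act.

Lemma HactM h1 h2 v : act (h1 * h2) v = act h1 (act h2 v).
Proof. by case: actP. Qed.

Lemma Hact1 v : act 1 v = v.
Proof. by case: actP. Qed.

Lemma HactDl h1 h2 v : act (h1 + h2) v = act h1 v + act h2 v.
Proof. by case: actP => _ D _ _; rewrite -[h1]scale1r D !scale1r. Qed.

Lemma HactDr h u v : act h (u + v) = act h u + act h v.
Proof. by case: actP => D _ _ _; rewrite -[u]scale1r D !scale1r. Qed.

Lemma Hact0l v : act 0 v = 0.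
Proof. by apply: (addrI (act 0 v)); rewrite -HactDl !addr0. Qed.

Lemma Hact0r h : act h 0 = 0.
Proof. by apply: (addrI (act h 0)); rewrite -HactDr !addr0. Qed.

Lemma HactZl k h v : act (k *: h) v = k *: act h v.
Proof. by case: actP => _ D _ _; rewrite -[k *: h]addr0 D Hact0l addr0. Qed.

Lemma HactZr k h v : act h (k *: v) = k *: act h v.
Proof. by case: actP => D _ _ _; rewrite -[k *: v]addr0 D Hact0r addr0. Qed.

Lemma HactBl h1 h2 v : act (h1 - h2) v = act h1 v - act h2 v.
Proof. by rewrite HactDl -(scaleN1r h2) HactZl scaleN1r. Qed.

Lemma Hact_alg k v : act k%:A v = k *: v.
Proof. by rewrite HactZl Hact1. Qed.

Lemma Hact_suml I (r : seq I) (P : pred I) (F : I -> H) v :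
  act (\sum_(i <- r | P i) F i) v = \sum_(i <- r | P i) act (F i) v.
Proof. by apply: (big_morph (act^~ v)) => [h1 h2|]; rewrite ?HactDl ?Hact0l. Qed.

Lemma Hact_prod_eigen I (r : seq I) (P : pred I) (F : I -> H) (f : I -> K) v :
  (forall i, P i -> act (F i) v = f i *: v) ->
  act (\prod_(i <- r | P i) F i) v = (\prod_(i <- r | P i) f i) *: v.
Proof.
move=> Fv; elim: r => [|i r IHr]; first by rewrite !big_nil Hact1 scale1r.
rewrite !big_cons; case: ifP => // Pi.
by rewrite HactM IHr HactZr Fv // scalerA mulrC.
Qed.

Lemma Hact_comm h1 h2 v : GRing.comm h1 h2 -> act h1 (act h2 v) = act h2 (act h1 v).
Proof. by move=> h12; rewrite -!HactM h12. Qed.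

End Action.

Section Weights.
Variables (K : fieldType) (t : K) (H : algType K).
Variables (V : lmodType K) (act : H -> V -> V).
Hypotheses (t0 : t != 0) (actP : is_Hmod act).
Implicit Types (T Y Yi : nat -> H) (a : nat -> K).

Lemma alg_comm (k : K) (x : H) : GRing.comm k%:A x.
Proof. by rewrite /GRing.comm -scalerAl -scalerAr mul1r mulr1. Qed.

(** Induction removing the first strand: the factors [Y 0 - a k] collapse the down sum to its first
    term, leaving scalars times the same problem on the remaining strands. *)
Lemma delta_sgn_prod n T Y Yi a v : hecke_rels t n T Y Yi ->
  (forall i, (i < n)%N -> act (Y i) v = a i *: v) ->
  act (delta n Y (fun i => (a i)%:A) * sgn_prod t n T) v
  = delta n a (fun i => t ^- 2 * a i) *: v.
Proof.
elim: n T Y Yi a => [|n IHn] T Y Yi a heckeTY Yv.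
  by rewrite /= mulr1 (Hact1 actP) scale1r.
have heckeTY' := hecke_rels_shift heckeTY.
have heckeT := hecke_rels_finite t0 heckeTY; have heckeT' := finite_hecke_shift heckeT.
have [_ _ _ commY [_ _ commTY]] := heckeTY.
rewrite delta_recl //; last by move=> *; exact: alg_comm.
rewrite delta_recl; try by move=> *; exact: mulrC.
rewrite [sgn_prod _ _ _]/=.
set x := sgn_prod t n _; set p := t ^- 2.
have xT i : (i.+2 < n.+1)%N -> x * T i.+1 = - t^-1 *: x.
  by move=> ?; exact: (sgn_prod_right_sgn t0 heckeT').
have Y0x : GRing.comm (Y 0%N) x.
  by apply: comm_sgn_prod => i ? /=; rewrite /GRing.comm commTY.
pose X k := act (x * down_sum t k T) v.
have stepX k : (k < n.+1)%N ->
    act (Y 0%N - (a k)%:A) (X k.+1) = act (Y 0%N - (p * a k)%:A) (X k).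
  move=> lt_kn; rewrite /X !(HactBl actP) !(Hact_alg actP) -!(HactM actP).
  have := Y0_down_word t0 heckeTY xT lt_kn.
  rewrite -Y0x -(mulrA _ x) scalerAr.
  have -> : (- t^-1) ^+ k *: (x * \prod_(i < k) T i)
      = x * down_sum t k.+1 T - x * down_sum t k T.
    by rewrite /down_sum big_nat_recr //= mulrDr addrAC subrr add0r scalerAr.
  rewrite mulrBr => /(congr1 (act^~ v)).
  rewrite (HactBl actP) (HactM actP) Yv // (HactZr actP).
  rewrite mulrBr (HactBl actP) // -scalerAr (HactZl actP) // scalerBr scalerA => /eqP.
  rewrite subr_eq => /eqP ->; rewrite [p * _]mulrC.
  by rewrite addrAC [X in X + _]addrAC subrr add0r addrC.
have Y0comm k l : GRing.comm (Y 0%N - (k : K)%:A) (Y 0%N - (l : K)%:A).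
  apply: commrB; last exact: (commr_sym (alg_comm _ _)).
  by apply: commr_sym; apply: commrB; last exact: (commr_sym (alg_comm _ _)).
(* The factors commute, so the one with the largest index acts first and lowers [X m.+1] to [X m].
   The product starts at [k = 1] because the descent stops at [X 1], which is [act x v]. *)
have prodX m : (m < n.+1)%N ->
    act (\prod_(1 <= k < m.+1) (Y 0%N - (a k)%:A)) (X m.+1)
    = act (\prod_(1 <= k < m.+1) (Y 0%N - (p * a k)%:A)) (X 1%N).
  elim: m => [|m IHm] lt_mn; first by rewrite !big_geq.
  rewrite !(@big_nat_recr _ _ _ m.+1) //= (HactM actP) // stepX //.
  rewrite (Hact_comm actP); last first.
    by apply: commr_sym; rewrite big_nat; apply: commr_prod.
  rewrite IHm ?(ltnW lt_mn) // (Hact_comm actP) -?(HactM actP) //.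
  by rewrite big_nat; apply: commr_prod.
have eigen0 k : act (Y 0%N - (p * a k)%:A) (act x v) = (a 0%N - p * a k) *: act x v.
  rewrite (HactBl actP) (Hact_alg actP) scalerBl -(HactM actP) Y0x (HactM actP).
  by rewrite Yv // (HactZr actP).
rewrite -mulrA (HactM actP) // (HactM actP) // -/(X n.+1) prodX //.
have -> : X 1%N = act x v.
  by rewrite /X /down_sum big_nat1 big_ord0 scale1r mulr1.
rewrite (Hact_prod_eigen actP _ (fun k _ => eigen0 k)) (HactZr actP) -(HactM actP).
rewrite (mulrC (delta _ _ _)) -scalerA.
congr (_ *: _); apply: (IHn _ _ _ (a \o succn) heckeTY') => i ?; exact: Yv.
Qed.

End Weights.

(** * The sign vector *)

(** The generating polynomial of the elementary symmetric functions, signed so that its value at a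
    scalar [b] is the product of the [y i - b]. *)
Definition root_poly (R : nzRingType) n (y : nat -> R) : {poly R} :=
  \prod_(i < n) ((y i)%:P - 'X).

(** * Polynomials over the Hecke algebra applied to a vector *)

Section Annihilator.
Variables (K : fieldType) (H : algType K) (V : lmodType K) (act : H -> V -> V).
Hypothesis actP : is_Hmod act.

(** This encodes [q u = 0] among polynomials with coefficients in [V]. *)
Definition kills (q : {poly H}) (u : V) := forall m, act q`_m u = 0.

Lemma killsB q r u : kills q u -> kills r u -> kills (q - r) u.
Proof. by move=> qu ru m; rewrite coefB (HactBl actP) qu ru subrr. Qed.

Lemma killsMl s q u : kills q u -> kills (s * q) u.
Proof.
move=> qu m; rewrite coefM (Hact_suml actP) big1 // => i _.
by rewrite (HactM actP) qu Hact0r.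
Qed.

Lemma killsMC q g u : kills (q * g%:P) u <-> kills q (act g u).
Proof. by split=> qu m; have := qu m; rewrite coefMC (HactM actP). Qed.

Lemma killsC g u : kills g%:P u <-> act g u = 0.
Proof.
split=> [/(_ 0)|gu m]; first by rewrite coefC.
by rewrite coefC; case: ifP => _ //; rewrite Hact0l.
Qed.

(** The coefficient of degree [m.+1] of the product is [b] times that of [q] minus the coefficient
    of [q] in degree [m], so the coefficients of [q] are shown to kill [u] from the top degree
    down. *)
Lemma kills_cancel b q u : kills ((b%:A%:P - 'X) * q) u -> kills q u.
Proof.
move=> bq_u m; have [k] := ubnP (size q - m)%N; elim: k m => // k IHk m lt_k.
have [le_qm|lt_mq] := leqP (size q) m; first by rewrite nth_default // Hact0l.
have := bq_u m.+1; rewrite mulrBl coefB coefCM coefXM (HactBl actP) (HactM actP) /=.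
rewrite (IHk m.+1); last by lia.
by rewrite (Hact0r actP) sub0r => /eqP; rewrite oppr_eq0 => /eqP.
Qed.

Lemma kills_horner b q u : kills q u -> act q.[b%:A] u = 0.
Proof.
move=> qu; rewrite horner_coef (Hact_suml actP) big1 // => i _.
have -> : q`_i * b%:A ^+ i = b ^+ i *: q`_i.
  by rewrite exprZn expr1n -scalerAr mulr1.
by rewrite (HactZl actP) qu scaler0.
Qed.

Lemma horner_prod_sub I (r : seq I) (y : I -> H) b :
  (\prod_(i <- r) ((y i)%:P - 'X)).[b%:A] = \prod_(i <- r) (y i - b%:A).
Proof.
elim: r => [|i r IHr]; first by rewrite !big_nil hornerC.
rewrite !big_cons hornerM_comm; first by rewrite IHr !hornerE.
exact: alg_comm.
Qed.

Lemma polyX_sub_comm (b : K) (q : {poly H}) : GRing.comm (b%:A%:P - 'X) q.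
Proof.
apply/commr_sym/commrB; last exact: commr_polyX.
by apply/polyP => m; rewrite coefCM coefMC; apply: commr_sym; exact: alg_comm.
Qed.

(* The divided difference [(F X - F b) / (b - X)] of [F = \prod_(i <= n) (y i - X)]. *)
Definition root_quot n (y : nat -> H) (b : K) : {poly H} :=
  \sum_(0 <= j < n.+1) (\prod_(i < j) (y i - b%:A))%:P *
    \prod_(j.+1 <= i < n.+1) ((y i)%:P - 'X).

Lemma root_quotM n y b :
  (b%:A%:P - 'X) * root_quot n y b
  = root_poly n.+1 y - (root_poly n.+1 y).[b%:A]%:P.
Proof.
rewrite /root_poly horner_prod_sub /root_quot mulr_sumr.
(* [G j] has [b] substituted for [X] in its first [j] factors; consecutive differences are [b - X]
   times the terms of [root_quot]. *)
pose G j : {poly H} := (\prod_(i < j) (y i - b%:A))%:P *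
  \prod_(j <= i < n.+1) ((y i)%:P - 'X).
rewrite -(big_mkord xpredT (fun i => (y i)%:P - 'X)).
have -> : \prod_(0 <= i < n.+1) ((y i)%:P - 'X) = G 0.
  by rewrite /G big_ord0 mul1r.
have -> : (\prod_(i < n.+1) (y i - b%:A))%:P = G n.+1.
  by rewrite /G [X in _ * X]big_geq // mulr1.
rewrite -[RHS]opprB -(telescope_sumr G) // -sumrN big_nat [RHS]big_nat.
apply: eq_bigr => j /andP[_ lt_jn]; rewrite /G big_ord_recr /= opprB.
rewrite (big_ltn lt_jn) mulrA -mulrBl mulrA polyX_sub_comm; congr (_ * _).
by rewrite polyCM -mulrBr polyCB; congr (_ * _); rewrite opprB [RHS]addrC addrA subrK.
Qed.

End Annihilator.

Section SignVector.
Variables (K : fieldType) (t : K) (H : algType K).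
Variables (V : lmodType K) (act : H -> V -> V).
Hypotheses (t0 : t != 0) (actP : is_Hmod act).
Variables (T Y Yi : nat -> H) (a : nat -> K).
Let ca i : H := (a i)%:A.
Let p := t ^- 2.

(** The factors at [i] and [i.+1] both occur, and their product is symmetric in [Y i] and [Y i.+1];
    every other factor commutes with [T i]. *)
Lemma T_comm_Yprod n i m b : hecke_rels t n T Y Yi -> (i.+1 < m)%N -> (m <= n)%N ->
  GRing.comm (T i) (\prod_(j < m) (Y j - b%:A)).
Proof.
move=> heckeTY lt_im le_mn; have [_ _ _ _ [_ _ commTY]] := heckeTY.
have commTYb j : (j < n)%N -> j != i -> j != i.+1 -> GRing.comm (T i) (Y j - b%:A).
  move=> *; apply: commrB; first exact: commTY (leq_trans lt_im le_mn) _ _ _.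
  exact: (commr_sym (alg_comm _ _)).
rewrite -(big_mkord xpredT (fun j => Y j - b%:A)) (@big_cat_nat _ _ _ i) //=; last lia.
rewrite (@big_ltn _ _ _ i) ?(ltnW lt_im) // (@big_ltn _ _ _ i.+1) // (mulrA (Y i - _)).
apply: commrM; first by apply: comm_prod_nat => j ?; apply: commTYb; lia.
apply: commrM; last by apply: comm_prod_nat => j ?; apply: commTYb; lia.
have lt_in : (i.+1 < n)%N by lia.
have -> : (Y i - b%:A) * (Y i.+1 - b%:A)
    = Y i * Y i.+1 - b *: (Y i + Y i.+1) + (b * b)%:A.
  rewrite mulrBl !mulrBr -!scalerAl -!scalerAr !mul1r mulr1 scalerA scalerDr.
  by rewrite !opprD opprK !addrA.
apply: commrD; last exact: (commr_sym (alg_comm _ _)).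
apply: commrB; first exact: (T_comm_YM heckeTY).
by rewrite /GRing.comm -scalerAl -scalerAr (T_comm_YD t0 heckeTY).
Qed.

Lemma Ysub_comm n i j b c : hecke_rels t n T Y Yi -> (i < n)%N -> (j < n)%N ->
  GRing.comm (Y i - b%:A) (Y j - c%:A).
Proof.
case=> _ _ _ commY _ lt_in lt_jn; apply: commrB; last exact: (commr_sym (alg_comm _ _)).
apply: commr_sym; apply: commrB; last exact: (commr_sym (alg_comm _ _)).
exact: commY.
Qed.

(** Here [T j * Y j] is [Y j.+1] times the inverse of [T j]. The passage from [b] to [p * b] is the
    ratio of the eigenvalues [- t^-1] of [T j] and [- t] of its inverse on [u]. *)
Lemma T_Ysub_sgn n j b u : hecke_rels t n T Y Yi -> (j.+1 < n)%N ->
  act (T j) u = - t^-1 *: u ->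
  - t^-1 *: act (T j * (Y j - b%:A)) u = act (Y j.+1 - (p * b)%:A) u.
Proof.
move=> heckeTY lt_jn Tu; rewrite mulrBr (TY t0 heckeTY) // !(HactBl actP) !(HactM actP).
rewrite (HactBl actP) Tu !(Hact_alg actP) (HactZr actP) Tu -scalerBl (HactZr actP).
rewrite scalerBr !scalerA; congr (_ - _ *: _); last by rewrite /p; field.
by rewrite -[RHS]scale1r; congr (_ *: _); field.
Qed.

(** Descending induction on [j]: each new letter [T j] replaces the factor [Y j - b] by
    [Y j.+1 - p * b], by [T_Ysub_sgn], and commutes with the other factors. *)
Lemma up_word_sgn n j b u : hecke_rels t n.+1 T Y Yi -> (j <= n)%N ->
  (forall i, (i < n)%N -> act (T i) u = - t^-1 *: u) ->
  (- t^-1) ^+ (n - j) *: act (\prod_(j <= k < n) T k * \prod_(i < n) (Y i - b%:A)) u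
  = act (\prod_(i < j) (Y i - b%:A) * \prod_(j.+1 <= i < n.+1) (Y i - (p * b)%:A)) u.
Proof.
move=> heckeTY le_jn Tu; have [_ _ _ _ [_ _ commTY]] := heckeTY.
have commTYb k i x : (k < n)%N -> (i < n.+1)%N -> i != k -> i != k.+1 ->
    GRing.comm (T k) (Y i - x%:A).
  move=> *; apply: commrB; first exact: commTY.
  exact: (commr_sym (alg_comm _ _)).
have [d] := ubnP (n - j)%N; elim: d j le_jn => // d IHd j le_jn lt_d.
have [lt_jn|le_nj] := ltnP j n; last first.
  have -> : j = n by apply/eqP; rewrite eqn_leq le_jn.
  by rewrite subnn !big_geq // scale1r mul1r mulr1.
rewrite -(subnSK lt_jn) (big_ltn lt_jn) -mulrA (HactM actP) exprS -scalerA.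
rewrite -(HactZr actP _ (T j)) IHd //; last by lia.
set R := \prod_(j.+2 <= i < n.+1) _; set L := \prod_(i < j) _.
have TL : GRing.comm (T j) L.
  by apply: commr_prod => i _; apply: commTYb; have := ltn_ord i; lia.
have TR : GRing.comm (T j) R by apply: comm_prod_nat => i ?; apply: commTYb; lia.
have YR x : GRing.comm (Y j - x%:A) R.
  by apply: comm_prod_nat => i ?; apply: (Ysub_comm _ _ heckeTY); lia.
have YR' x : GRing.comm (Y j.+1 - x%:A) R.
  by apply: comm_prod_nat => i ?; apply: (Ysub_comm _ _ heckeTY); lia.
rewrite big_ord_recr /= -/L -(mulrA L) YR -(HactM actP) mulrA TL -mulrA.
rewrite (mulrA (T j)) TR -mulrA !(HactM actP L) -(HactZr actP); congr act.
rewrite (HactM actP R) -(HactZr actP) (T_Ysub_sgn _ heckeTY) ?Tu //.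
by rewrite (@big_ltn _ _ _ j.+1) // -/R YR' (HactM actP).
Qed.

(* The partial sums of [sgn_sum] applied to a product of linear factors become the
   divided difference [root_quot], which the central character evaluates. *)
Lemma delta_sgn_sum n u : hecke_rels t n T Y Yi ->
  (forall i, (i.+1 < n)%N -> act (T i) u = - t^-1 *: u) ->
  kills act (root_poly n Y - root_poly n ca) u ->
  (forall i, (i < n)%N -> act (Y i) (act (delta n Y ca) u) = a i *: act (delta n Y ca) u) /\
  act (sgn_sum t n T * delta n Y ca) u = delta n a (fun i => p * a i) *: u.
Proof.
elim: n u => [|n IHn] u heckeTY Tu Fu.
  by rewrite sgn_sum0 /= mulr1 (Hact1 actP) scale1r; split.
have heckeTY' := hecke_rels_widen heckeTY.
have [_ _ _ commY [_ _ commTY]] := heckeTY.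
set b := a n; pose g := \prod_(i < n) (Y i - b%:A); pose m := act g u.
have Fb c : act (\prod_(i < n.+1) (Y i - c%:A)) u = (\prod_(i < n.+1) (a i - c)) *: u.
  have := kills_horner actP c Fu.
  rewrite hornerD hornerN /root_poly !horner_prod_sub (HactBl actP).
  move/eqP; rewrite subr_eq0 => /eqP ->.
  rewrite (Hact_prod_eigen actP _ (f := fun i : 'I_n.+1 => a i - c)) //.
  by move=> i _; rewrite (HactBl actP) !(Hact_alg actP) scalerBl.
(* Since [b = a n] is a root of the scalar polynomial, [Fb] at [b] says that [Y n - b] kills [m]. *)
have Ynm : act (Y n) m = b *: m.
  have := Fb b; rewrite [X in X *: u]big_ord_recr /= subrr mulr0 scale0r big_ord_recr /= -/g.
  have -> : g * (Y n - b%:A) = (Y n - b%:A) * g.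
    apply: commr_sym; apply: commr_prod => i _; apply: commrB; last first.
      exact: (commr_sym (alg_comm _ _)).
    apply: commr_sym; apply: commrB; last exact: (commr_sym (alg_comm _ _)).
    by apply: commY; rewrite // ltnS ltnW.
  by rewrite (HactM actP) -/m (HactBl actP) (Hact_alg actP) => /eqP; rewrite subr_eq0 => /eqP.
have Tm i : (i.+1 < n)%N -> act (T i) m = - t^-1 *: m.
  move=> lt_in; rewrite /m (Hact_comm actP) ?Tu ?(HactZr actP) ?ltnS 1?ltnW //.
  exact: (T_comm_Yprod b heckeTY lt_in (leqnSn n)).
(* After multiplication by [b - X] the difference becomes the one for [n.+1] strands, which kills
   [u] and hence [m], minus a multiple of [Y n - b], which kills [m]. *)
have Fm : kills act (root_poly n Y - root_poly n ca) m.
  apply: (kills_cancel actP (b := b)); rewrite polyX_sub_comm.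
  rewrite mulrBl.
  have -> : root_poly n ca * (b%:A%:P - 'X) = root_poly n.+1 ca.
    by rewrite /root_poly big_ord_recr.
  have -> : root_poly n Y * (b%:A%:P - 'X) - root_poly n.+1 ca =
    (root_poly n.+1 Y - root_poly n.+1 ca) - root_poly n Y * (Y n - b%:A)%:P.
    rewrite /root_poly [\prod_(i < n.+1) ((Y i)%:P - _)]big_ord_recr /= addrAC -mulrBr.
    by congr (_ * _ - _); rewrite polyCB opprB [RHS]addrC addrA subrK.
  apply: killsB => //.
    apply/(killsMC actP); have gF y : (forall i, (i < n.+1)%N -> GRing.comm g (y i)) ->
        GRing.comm g%:P (root_poly n.+1 y).
      move=> gy; apply: commr_prod => i _; apply: commrB; last exact: commr_polyX.
      by rewrite /GRing.comm -!polyCM gy.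
    have -> : (root_poly n.+1 Y - root_poly n.+1 ca) * g%:P
        = g%:P * (root_poly n.+1 Y - root_poly n.+1 ca).
      apply: commr_sym; apply: commrB; apply: gF => i lt_in; last first.
        exact: (commr_sym (alg_comm _ _)).
      apply: commr_sym; apply: commr_prod => k _; apply: commrB.
        by apply: commY => //; apply: ltnW; rewrite ltnS.
      exact: (commr_sym (alg_comm _ _)).
    exact: killsMl.
  apply/killsMl/killsC => //.
  by rewrite (HactBl actP) (Hact_alg actP) Ynm subrr.
have [Ydelta sgn_delta] := IHn m heckeTY' Tm Fm.
have deltaS v : act (delta n.+1 Y ca) v = act (delta n Y ca) (act g v).
  by rewrite -(HactM actP).
split=> [i|].
  rewrite deltaS ltnS leq_eqVlt => /predU1P[->|]; last exact: Ydelta.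
  rewrite (Hact_comm actP) ?Ynm ?(HactZr actP) //.
  apply: comm_delta => [k lt_kn|k x]; last exact: alg_comm.
  by apply: commY => //; apply: ltnW.
rewrite sgn_sumS -mulrA (HactM actP) (HactM actP) deltaS -/m.
rewrite -(HactM actP (sgn_sum _ _ _)) sgn_delta.
rewrite (HactZr actP) /= -/b -scalerA; congr (_ *: _).
(* Multiplying by [b - X] reduces this to [Fu] and to the vanishing on [u] of the value at [b]. *)
have quotE : kills act (root_quot n Y b - root_poly n ca) u.
  apply: (kills_cancel actP (b := b)); rewrite mulrBr root_quotM.
  have -> : (b%:A%:P - 'X) * root_poly n ca = root_poly n.+1 ca.
    by rewrite polyX_sub_comm /root_poly big_ord_recr.
  rewrite addrAC; apply: killsB => //; apply/killsC => //.
  by rewrite /root_poly horner_prod_sub Fb big_ord_recr /= subrr mulr0 scale0r.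
(* At [X = p * b] the terms of [root_quot] act on [u] as those of [up_sum] times [g], by
   [up_word_sgn]. *)
have := kills_horner actP (p * b) quotE.
rewrite hornerD hornerN (HactBl actP) => /eqP; rewrite subr_eq0 /root_poly horner_prod_sub.
rewrite (Hact_prod_eigen actP _ (f := fun i : 'I_n => a i - p * b)); last first.
  by move=> i _; rewrite (HactBl actP) !(Hact_alg actP) scalerBl.
move=> /eqP <-; rewrite /m -(HactM actP) /up_sum /root_quot mulr_suml horner_sum.
rewrite !(Hact_suml actP) big_nat [RHS]big_nat; apply: eq_bigr => j /andP[_ le_jn].
rewrite hornerCM horner_prod_sub -(up_word_sgn b heckeTY) //.
by rewrite -scalerAl (HactZl actP).
Qed.

End SignVector.

(** * Symmetric Laurent polynomials *)

Section LaurentPolynomials.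
Variables (K : fieldType) (n : nat).
Implicit Types (f : lpoly K n) (e : {ffun 'I_n -> int}).

(** A formal sum may repeat an exponent; collecting terms over a duplicate-free list shows that
    evaluation depends only on [lcoef]. *)
Lemma sum_lcoef (V : lmodType K) (F : {ffun 'I_n -> int} -> V) f (S : seq {ffun 'I_n -> int}) :
  uniq S -> {subset map snd f <= S} ->
  \sum_(p <- f) p.1 *: F p.2 = \sum_(e <- S) lcoef f e *: F e.
Proof.
move=> uS fS; under [RHS]eq_bigr => e _ do rewrite /lcoef scaler_suml big_mkcond.
rewrite exchange_big /= big_seq [RHS]big_seq; apply: eq_bigr => p fp.
rewrite (bigD1_seq p.2) ?fS ?map_f //= eqxx big1 ?addr0 // => e.
by rewrite eq_sym => /negPf ->.
Qed.

Lemma eq_sum_lcoef (V : lmodType K) (F : {ffun 'I_n -> int} -> V) f g :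
  lcoef f =1 lcoef g -> \sum_(p <- f) p.1 *: F p.2 = \sum_(p <- g) p.1 *: F p.2.
Proof.
move=> fg; pose S := undup (map snd f ++ map snd g).
rewrite !(@sum_lcoef _ _ _ S) ?undup_uniq //.
- by apply: eq_bigr => e _; rewrite fg.
- by move=> e ?; rewrite mem_undup mem_cat orbC; apply/orP; left.
- by move=> e ?; rewrite mem_undup mem_cat; apply/orP; left.
Qed.

Lemma sum_lsym (V : lmodType K) (F : {ffun 'I_n -> int} -> V) f (s : 'S_n) : lsym f ->
  \sum_(p <- f) p.1 *: F p.2 = \sum_(p <- f) p.1 *: F [ffun i => p.2 (s i)].
Proof.
move=> fsym; 
pose g : lpoly K n :=
  [seq (p.1, [ffun i => p.2 (s i)]) | p : K * {ffun 'I_n -> int} <- f].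
rewrite (eq_sum_lcoef F (g := g)); first by rewrite big_map.
move=> e; rewrite -(fsym s^-1%g e) /lcoef big_map; apply: eq_bigl => p /=.
apply/eqP/eqP => [->|<-]; apply/ffunP => i; rewrite !ffunE; first by rewrite permK.
by rewrite permKV.
Qed.

(** The degree [m] coefficient of [root_poly] as a formal sum: [J] is the set of factors that
    contribute their variable, the others giving [- X]. *)
Definition esym_lpoly m : lpoly K n :=
  [seq ((-1) ^+ m, [ffun i => (i \in J : nat)%:Z] : {ffun 'I_n -> int}) |
    J : {set 'I_n} <- enum [set J : {set 'I_n} | #|~: J| == m]].

Lemma lsym_esym m : lsym (esym_lpoly m).
Proof.
move=> s e; rewrite /lcoef !big_map !big_enum_cond /=.
rewrite [LHS](reindex_inj (h := fun J : {set 'I_n} => s @^-1: J)) /=; last first.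
  move=> J1 J2 /setP eqJ; apply/setP => i; have := eqJ (s^-1%g i).
  by rewrite !inE permKV.
apply: eq_bigl => J; rewrite !inE -preimsetC card_preimset; last exact: perm_inj.
congr (_ && _); apply/eqP/eqP => [/ffunP eJ|<-]; apply/ffunP => i.
  by have := eJ (s^-1%g i); rewrite !ffunE inE permKV.
by rewrite !ffunE inE.
Qed.

Lemma coef_root_poly (R : nzRingType) (y : nat -> R) m :
  (root_poly n y)`_m =
  \sum_(J : {set 'I_n} | #|~: J| == m) (-1) ^+ m * \prod_(i < n) (if i \in J then y i else 1).
Proof.
rewrite /root_poly bigA_distr coef_sum [RHS]big_mkcond /=; apply: eq_bigr => J _.
have -> : \prod_(i < n) (if i \in J then (y i)%:P else - 'X)
    = (\prod_(i < n) (if i \in J then y i else 1))%:P * (- 'X) ^+ #|~: J|.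
  rewrite -sum1_card [X in _ ^+ X]big_mkcond /=.
  elim: (index_enum _) => [|i r IHr]; first by rewrite !big_nil mulr1.
  rewrite !big_cons IHr inE; case: ifP => _ /=; first by rewrite add0n polyCM mulrA.
  rewrite add1n exprS mul1r !mulrA; congr (_ * _).
  apply: commr_sym; apply: commrN; exact: commr_polyX.
have -> : (- 'X) ^+ #|~: J| = ((-1) ^+ #|~: J|)%:P * 'X^#|~: J| :> {poly R}.
  by rewrite (exprNn 'X) polyC_exp polyCN.
rewrite !coefCM coefXn eq_sym; case: eqP => [->|_]; last by rewrite !mulr0.
by rewrite mulr1; apply: commr_sign.
Qed.

End LaurentPolynomials.

(** * Symmetric Laurent polynomials commute with the finite Hecke algebra *)

Section Central.
Variables (K : fieldType) (t : K) (H : algType K).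
Hypothesis t0 : t != 0.
Variables (n : nat) (T Y Yi : nat -> H).
Hypothesis heckeTY : hecke_rels t n T Y Yi.

Lemma Ypow_addn i z k : (i < n)%N -> Ypow Y Yi i (z + k%:Z) = Ypow Y Yi i z * Y i ^+ k.
Proof.
move=> lt_in; have [_ _ _ _ [invY _ _]] := heckeTY; have [YYi YiY] := invY i lt_in.
elim: k => [|k IHk]; first by rewrite addr0 mulr1.
rewrite exprSr mulrA -IHk -addn1 PoszD addrA; move: (z + k) => {IHk} [j|[|j]] /=.
- by rewrite addn1 exprSr.
- by rewrite expr1 YiY.
by rewrite subn1 [in RHS]exprSr -mulrA YiY mulr1.
Qed.

Lemma comm_inv (x w w' : H) : w * w' = 1 -> w' * w = 1 -> GRing.comm x w -> GRing.comm x w'.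
Proof.
move=> ww' w'w xw; rewrite /GRing.comm -[LHS]mul1r -w'w -mulrA (mulrA w) -xw.
by rewrite -!mulrA ww' mulr1.
Qed.

Lemma T_comm_Ypow i z : (i.+1 < n)%N ->
  GRing.comm (T i) (Ypow Y Yi i z * Ypow Y Yi i.+1 z).
Proof.
move=> lt_in; have [_ _ _ commY [invY _ _]] := heckeTY.
have [YYi YiY] := invY _ (ltnW lt_in); have [YYi' YiY'] := invY _ lt_in.
have cYY : GRing.comm (Y i) (Y i.+1) by apply: commY => //; apply: ltnW.
have cYiY : GRing.comm (Yi i) (Y i.+1).
  by apply: commr_sym; apply: (comm_inv YYi YiY); apply: commr_sym.
have cYiYi : GRing.comm (Yi i) (Yi i.+1) by apply: (comm_inv YYi' YiY').
case: z => k /=; rewrite -exprMn_comm //; apply: commrX.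
  exact: T_comm_YM heckeTY _ lt_in.
apply: (comm_inv (w := Y i * Y i.+1)); last exact: T_comm_YM heckeTY _ lt_in.
  by rewrite cYiYi -mulrA (mulrA (Y i.+1)) YYi' mul1r YYi.
by rewrite cYY -mulrA (mulrA (Yi i.+1)) YiY' mul1r YiY.
Qed.

(** Newton's recursion writes each power sum in two variables through the two previous ones and the
    elementary symmetric functions. *)
Lemma T_comm_YXD i k : (i.+1 < n)%N -> GRing.comm (T i) (Y i ^+ k + Y i.+1 ^+ k).
Proof.
move=> lt_in; have [_ _ _ commY _] := heckeTY.
have cYY : GRing.comm (Y i) (Y i.+1) by apply: commY => //; apply: ltnW.
have [m] := ubnP k; elim: m k => // m IHm [|[|k]] lt_km.
- by apply: commrD; apply: commr1.
- exact: (T_comm_YD t0 heckeTY).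
have -> : Y i ^+ k.+2 + Y i.+1 ^+ k.+2 = (Y i + Y i.+1) * (Y i ^+ k.+1 + Y i.+1 ^+ k.+1)
    - Y i * Y i.+1 * (Y i ^+ k + Y i.+1 ^+ k).
  have e1 : Y i.+1 * Y i ^+ k.+1 = Y i * Y i.+1 * Y i ^+ k by rewrite cYY -mulrA -exprS.
  have e2 : Y i * Y i.+1 ^+ k.+1 = Y i * Y i.+1 * Y i.+1 ^+ k by rewrite -mulrA -exprS.
  rewrite mulrDl !mulrDr -!exprS e1 e2; move: (_ * Y i ^+ k) (_ * _ ^+ k) => z1 z2.
  by rewrite (addrC z1 (_ ^+ _)) addrACA (addrC z2) addrK.
apply: commrB; apply: commrM; first exact: (T_comm_YD t0 heckeTY).
- by apply: IHm; lia.
- exact: (T_comm_YM heckeTY).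
by apply: IHm; lia.
Qed.

(** With [z = x + k], which symmetry allows, the sum is the symmetric monomial of exponent [x] times
    the power sum of exponent [k]. *)
Lemma T_comm_Ymon i x z : (i.+1 < n)%N ->
  GRing.comm (T i) (Ypow Y Yi i x * Ypow Y Yi i.+1 z + Ypow Y Yi i z * Ypow Y Yi i.+1 x).
Proof.
move=> lt_in; have [_ _ _ commY [invY _ _]] := heckeTY.
wlog [k ->] : x z / exists k : nat, z = x + k%:Z.
  move=> IH; have [le_xz|lt_zx] := lerP x z.
    by apply: IH; exists `|z - x|%N; rewrite gez0_abs ?subr_ge0 // [RHS]addrC subrK.
  rewrite addrC; apply: IH; exists `|x - z|%N.
  by rewrite gez0_abs ?subr_ge0 ?ltW // [RHS]addrC subrK.
rewrite !Ypow_addn ?(ltnW lt_in) //.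
have YiYpow : GRing.comm (Y i ^+ k) (Ypow Y Yi i.+1 x).
  apply: commr_sym; apply: commrX.
  have cYY : GRing.comm (Y i) (Y i.+1) by apply: commY => //; apply: ltnW.
  have [YYi' YiY'] := invY _ lt_in.
  apply: commr_sym; case: (x) => m; apply: commrX => //; exact: (comm_inv YYi' YiY').
rewrite -(mulrA _ (Y i ^+ k)) YiYpow !mulrA -mulrDr addrC.
by apply: commrM; [exact: T_comm_Ypow | exact: T_comm_YXD].
Qed.

Hypothesis two_neq0 : 2%:R != 0 :> K.

(** Adding to [f] its image under the transposition gives twice [f], a combination of sums of a
    monomial and its swap; each such sum commutes with [T i], and 2 is cancelled. *)
Lemma T_comm_lsym (f : lpoly K n) i : (i.+1 < n)%N -> lsym f ->
  GRing.comm (T i) (levalH Y Yi f).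
Proof.
move=> lt_in fsym.
pose F (e : {ffun 'I_n -> int}) := \prod_(k < n) Ypow Y Yi k (e k).
pose s : 'S_n := tperm (Ordinal (ltnW lt_in)) (Ordinal lt_in).
have T_comm_F e : GRing.comm (T i) (F e + F [ffun k => e (s k)]).
  (* Exponents are extended by 0 to all naturals so that the product can be cut around [i] and
     [i.+1]. *)
  pose ext (e' : {ffun 'I_n -> int}) k := oapp e' 0 (insub k).
  pose L e' := \prod_(0 <= k < i) Ypow Y Yi k (ext e' k).
  pose R e' := \prod_(i.+2 <= k < n) Ypow Y Yi k (ext e' k).
  have extI e' k (lt_kn : (k < n)%N) : ext e' k = e' (Ordinal lt_kn).
    by rewrite /ext insubT.
  have FE e' : F e' = L e' * (Ypow Y Yi i (e' (Ordinal (ltnW lt_in))) *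
      Ypow Y Yi i.+1 (e' (Ordinal lt_in))) * R e'.
    have -> : F e' = \prod_(0 <= k < n) Ypow Y Yi k (ext e' k).
      by rewrite big_mkord; apply: eq_bigr => k _; rewrite /ext valK.
    rewrite (@big_cat_nat _ _ _ i) //=; last lia.
    rewrite (@big_ltn _ _ _ i) ?(ltnW lt_in) // (@big_ltn _ _ _ i.+1) //.
    by rewrite !mulrA -!extI.
  have T_comm_ext k e' : (k < n)%N -> k != i -> k != i.+1 ->
      GRing.comm (T i) (Ypow Y Yi k (ext e' k)).
    move=> lt_kn neq_ki neq_kiS; have [_ _ _ _ [invY _ commTY]] := heckeTY.
    have TYk : GRing.comm (T i) (Y k) by exact: commTY.
    have [YYi YiY] := invY k lt_kn.
    by case: (ext e' k) => m; apply: commrX => //; exact: (comm_inv YYi YiY).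
  have extE k : (k < n)%N -> k != i -> k != i.+1 ->
      ext [ffun k => e (s k)] k = ext e k.
    move=> lt_kn neq_ki neq_kiS; rewrite /ext insubT /= ffunE tpermD //.
      by rewrite eq_sym.
    by rewrite eq_sym.
  rewrite !FE !ffunE tpermL tpermR.
  have -> : L [ffun k => e (s k)] = L e by apply: eq_big_nat => k ?; rewrite extE //; lia.
  have -> : R [ffun k => e (s k)] = R e by apply: eq_big_nat => k ?; rewrite extE //; lia.
  rewrite -mulrDl -mulrDr; apply: commrM; first apply: commrM.
  - by apply: comm_prod_nat => k ?; apply: T_comm_ext; lia.
  - exact: T_comm_Ymon.
  by apply: comm_prod_nat => k ?; apply: T_comm_ext; lia.
have two_f : 2%:R *: levalH Y Yi f
    = \sum_(p <- f) p.1 *: (F p.2 + F [ffun k => p.2 (s k)]).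
  under eq_bigr do rewrite scalerDr.
  by rewrite big_split /= -(sum_lsym F s fsym) scaler_nat mulr2n.
have : GRing.comm (T i) (2%:R *: levalH Y Yi f).
  rewrite two_f; apply: commr_sum => p _.
  by rewrite /GRing.comm -scalerAl -scalerAr T_comm_F.
rewrite /GRing.comm -scalerAl -scalerAr; exact: scalerI.
Qed.

End Central.

(** * Comparison of the two induced modules *)

Section Induction.
Variables (K : fieldType) (t : K) (H : algType K) (n : nat).
Variables (T Y Yi : nat -> H) (a : 'I_n -> K) (b : nat -> K).
Hypothesis ab : forall i, b (val i) = a i.
Hypothesis heckeTY : hecke_rels t n T Y Yi.
Variables (V : lmodType K) (act : H -> V -> V).
Hypothesis actP : is_Hmod act.

Lemma levalH_esym m : levalH Y Yi (@esym_lpoly K n m) = (root_poly n Y)`_m.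
Proof.
rewrite coef_root_poly /levalH big_map big_enum /= (eq_bigl _ _ (fun=> in_set _ _)).
apply: eq_bigr => J _; have -> : (-1) ^+ m = ((-1) ^+ m)%:A :> H.
  by rewrite -in_algE rmorphXn rmorphN1.
rewrite -scalerAl mul1r; congr (_ *: _); apply: eq_bigr => i _.
by rewrite ffunE; case: (i \in J).
Qed.

Lemma levalK_esym m :
  (levalK a (@esym_lpoly K n m))%:A = (root_poly n (fun i => (b i)%:A : H))`_m.
Proof.
rewrite coef_root_poly /levalK big_map big_enum /= (eq_bigl _ _ (fun=> in_set _ _)).
rewrite -in_algE rmorph_sum; apply: eq_bigr => J _.
rewrite rmorphM rmorphXn rmorphN1 rmorph_prod; congr (_ * _); apply: eq_bigr => i _.
by rewrite ffunE; case: (i \in J); rewrite ?rmorph1 // /= ab.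
Qed.

(** The central character is needed only on the coefficients of [root_poly], which are symmetric. *)
Lemma central_kills u :
  (forall f : lpoly K n, lsym f -> act (levalH Y Yi f) u = levalK a f *: u) ->
  kills act (root_poly n Y - root_poly n (fun i => (b i)%:A)) u.
Proof.
move=> fu m; rewrite coefB -levalH_esym -levalK_esym (HactBl actP) (Hact_alg actP).
by rewrite fu ?subrr //; exact: lsym_esym.
Qed.

Lemma weight_lpoly (a0 : forall i, a i != 0) w :
  (forall i, (i < n)%N -> act (Y i) w = b i *: w) ->
  forall f : lpoly K n, act (levalH Y Yi f) w = levalK a f *: w.
Proof.
move=> Yw f; have [_ _ _ _ [invY _ _]] := heckeTY.
rewrite /levalH (Hact_suml actP) /levalK scaler_suml; apply: eq_bigr => p _.
rewrite (HactZl actP) -scalerA; congr (_ *: _).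
apply: (Hact_prod_eigen actP) => i _.
have Xw (h : H) (c : K) k : act h w = c *: w -> act (h ^+ k) w = c ^+ k *: w.
  move=> hw; elim: k => [|k IHk]; first by rewrite (Hact1 actP) scale1r.
  by rewrite exprS (HactM actP) IHk (HactZr actP) hw scalerA exprSr.
have Yiw : act (Yi i) w = (a i)^-1 *: w.
  apply: (scalerI (a0 i)); rewrite scalerA divff // scale1r -(HactZr actP) -ab.
  by rewrite -(Yw _ (ltn_ord i)) -(HactM actP) (invY i (ltn_ord i)).2 (Hact1 actP).
case: (p.2 i) => k; rewrite /exprz /Ypow; first by rewrite (Xw _ (a i)) // Yw ?ab.
by rewrite -exprVn (Xw _ _ _ Yiw).
Qed.

Lemma lpoly_weight w :
  (forall f : lpoly K n, act (levalH Y Yi f) w = levalK a f *: w) ->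
  forall i, (i < n)%N -> act (Y i) w = b i *: w.
Proof.
move=> fw i lt_in; pose o := Ordinal lt_in.
(* The hypothesis is tested on the single monomial [Y i]. *)
have := fw [:: (1, [ffun k => (k == o : nat)%:Z])].
rewrite /levalH /levalK !big_seq1 /= scale1r mul1r.
rewrite (eq_bigr (fun k : 'I_n => if k == o then Y k else 1)); last first.
  by move=> k _; rewrite ffunE; case: eqP => _; rewrite /= ?expr1.
rewrite [X in X *: _](eq_bigr (fun k : 'I_n => if k == o then a k else 1)); last first.
  by move=> k _; rewrite ffunE; case: eqP => _.
by rewrite -!big_mkcond !big_pred1_eq -ab.
Qed.

End Induction.

(** * Nonvanishing of the quantum factorial, and the isomorphism *)

(** The quantum integer of [2 m] at [t] is [1 + t] times that of [m] at [t ^ 2], and the latter is a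
    power of [t] times that of [m] at [t ^- 2]. *)
Lemma qint_invsqr_neq0 (K : fieldType) (t : K) :
  t != 0 -> (forall m : nat, (0 < m)%N -> qint t m != 0) ->
  forall m, (0 < m)%N -> qint (t ^- 2) m != 0.
Proof.
move=> t0 qt m m_gt0; apply: contraNneq (qt (m + m)%N _) => [qm0|]; last by lia.
have -> : qint t (m + m) = (1 + t) * \sum_(i < m) t ^+ 2 ^+ i.
  rewrite /qint; elim: (m) => [|k IHk]; first by rewrite !big_ord0 mulr0.
  rewrite addnS addSn !big_ord_recr /= IHk mulrDr -addrA; congr (_ + _).
  by rewrite -exprM mul2n -addnn mulrDl mul1r -exprS.
have -> : \sum_(i < m) t ^+ 2 ^+ i = t ^+ 2 ^+ m.-1 * qint (t ^- 2) m.
  rewrite /qint mulr_sumr (reindex_inj rev_ord_inj) /=; apply: eq_bigr => i _.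
  have -> : (m - i.+1 = m.-1 - i)%N by lia.
  rewrite expfB_cond ?exprVn // sqrf_eq0 (negPf t0) add0n.
  by have := ltn_ord i; lia.
by rewrite qm0 !mulr0.
Qed.

Lemma qfact_invsqr_neq0 (K : fieldType) (t : K) n :
  t != 0 -> (forall m : nat, (0 < m)%N -> qint t m != 0) -> qfact (t ^- 2) n != 0.
Proof.
move=> t0 qt; rewrite /qfact prodf_seq_neq0; apply/allP => i /=.
rewrite mem_index_iota => /andP[i_gt0 _].
exact: qint_invsqr_neq0.
Qed.

Theorem theorem3p22 (K : fieldType) (t : K) (n : nat)
  (H : algType K) (T Y Yi : nat -> H) (a : 'I_n -> K)
  (V1 : lmodType K) (act1 : H -> V1 -> V1) (u0 : V1)
  (V2 : lmodType K) (act2 : H -> V2 -> V2) (v0 : V2) :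
  [pchar K] =i pred0 ->
  t != 0 ->
  (forall m : nat, (0 < m)%N -> qint t m != 0) ->
  (1 <= n)%N ->
  is_affine_hecke t n T Y Yi ->
  (forall i, a i != 0) ->
  descending t a ->
  is_ind_SH t T Y Yi a act1 u0 ->
  is_ind_KY Y Yi a act2 v0 ->
  exists phi : V1 -> V2,
    [/\ is_Hmod_hom act1 act2 phi,
        phi u0 = act2 (sign_idem t n T) v0 &
        bijective phi].
Proof.
move=> char0 t0 qt n_gt0 [heckeTY _] a0 desc [act1P Tu0 fu0 univ1] [act2P fv0 univ2].
have two_neq0 : 2%:R != 0 :> K by rewrite ((pcharf0P K).1 char0).
(* [a] is extended by 0 to the naturals, since [delta] and [root_poly] take sequences. *)
pose b i := oapp a 0 (insub i : option 'I_n).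
have ab i : b (val i) = a i by rewrite /b valK.
have qn0 : qfact (t ^- 2) n != 0 by exact: qfact_invsqr_neq0.
have heckeT := hecke_rels_finite t0 heckeTY.
pose c := delta n b (fun i => t ^- 2 * b i).
have c0 : c != 0.
  (* A zero factor would give [a i / a j = t ^ (2 * z)] with [z = -1] and [i < j], against the
     descending condition. *)
  apply: delta_neq0 => i j lt_ij lt_jn; have lt_in := ltn_trans lt_ij lt_jn.
  apply/eqP => bij; have := desc (Ordinal lt_in) (Ordinal lt_jn) (-1) lt_ij.
  rewrite -!ab /= bij mulfK; last by have := a0 (Ordinal lt_jn); rewrite -ab.
  by move=> /(_ erefl).
pose D := delta n Y (fun i => (b i)%:A : H).
pose w2 := act2 (sign_idem t n T) v0.
have Yv0 := lpoly_weight ab fv0.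
have eE : sign_idem t n T = (qfact (t ^- 2) n)^-1 *: sgn_sum t n T by [].
have Tw2 i : (i.+1 < n)%N -> act2 (T i) w2 = - t^-1 *: w2.
  move=> lt_in; rewrite /w2 eE (HactZl act2P) (HactZr act2P) -(HactM act2P).
  by rewrite (sgn_sum_left_sgn t0 heckeT) // (HactZl act2P) !scalerA mulrC.
have fw2 (f : lpoly K n) : lsym f -> act2 (levalH Y Yi f) w2 = levalK a f *: w2.
  move=> fsym; have Tf i : (i.+1 < n)%N -> GRing.comm (T i) (levalH Y Yi f).
    by move=> ?; exact: (T_comm_lsym t0 heckeTY).
  have ef : GRing.comm (levalH Y Yi f) (sgn_sum t n T).
    (* For the product form it suffices to commute with the generators [T i]. *)
    rewrite -(sgn_prodE t0 heckeT) //; apply: comm_sgn_prod => i ?.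
    by apply: commr_sym; exact: (T_comm_lsym t0 heckeTY).
  rewrite /w2 eE (HactZl act2P) (HactZr act2P) -(HactM act2P) ef (HactM act2P) fv0.
  by rewrite !(HactZr act2P) !scalerA mulrC.
have [phi [[phi_hom phi_u0] phi_uniq]] := univ1 V2 act2 w2 act2P Tw2 fw2.
have [Yw1 ew1] := delta_sgn_sum t0 act1P heckeTY Tu0 (central_kills ab act1P fu0).
(* This factor cancels both [c] and the normalisation of [sign_idem] in the two composites. *)
pose k := qfact (t ^- 2) n / c.
have k0 : k != 0 by rewrite mulf_neq0 ?invr_neq0.
pose w1 := k *: act1 D u0.
have Yw1' i : (i < n)%N -> act1 (Y i) w1 = b i *: w1.
  by move=> lt_in; rewrite (HactZr act1P) Yw1 // !scalerA mulrC.
have [psi [[psi_hom psi_v0] psi_uniq]] :=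
  univ2 V1 act1 w1 act1P (weight_lpoly ab heckeTY act1P a0 Yw1').
have hom_comp (U V W : lmodType K) actU actV actW (f : V -> W) (g : U -> V) :
    @is_Hmod_hom _ H _ _ actV actW f -> is_Hmod_hom actU actV g ->
    is_Hmod_hom actU actW (f \o g).
  by move=> [f1 f2] [g1 g2]; split=> * /=; rewrite ?g1 ?f1 ?g2 ?f2.
have homZ (V W : lmodType K) actV actW (f : V -> W) x v :
    @is_Hmod_hom _ H _ _ actV actW f -> f (x *: v) = x *: f v.
  case=> f1 _; have f0 : f 0 = 0.
    by apply: (addrI (f 0)); rewrite -{1}[f 0]scale1r -f1 scale1r !addr0.
  by rewrite -[x *: v]addr0 f1 f0 addr0.
(* By the uniqueness clauses, an endomorphism fixing the generator is the identity, so each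
   composite need only be computed on [u0] or [v0]. *)
have [g1 [_ id1]] := univ1 V1 act1 u0 act1P Tu0 fu0.
have [g2 [_ id2]] := univ2 V2 act2 v0 act2P fv0.
have psi_phi : psi \o phi =1 id.
  rewrite -(id1 (psi \o phi)) ?(id1 id) //; split; first exact: hom_comp psi_hom phi_hom.
  rewrite /= phi_u0 psi_hom.2 psi_v0 eE (HactZl act1P) (HactZr act1P) -(HactM act1P).
  by rewrite ew1 !scalerA -/c /k -!mulrA mulVf // mulr1 mulVf // scale1r.
have phi_psi : phi \o psi =1 id.
  rewrite -(id2 (phi \o psi)) ?(id2 id) //; split; first exact: hom_comp phi_hom psi_hom.
  rewrite /= psi_v0 (homZ _ _ _ _ _ _ _ phi_hom) phi_hom.2 phi_u0 /w2 eE.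
  rewrite (HactZl act2P) (HactZr act2P) -(HactM act2P) -(sgn_prodE t0 heckeT) //.
  rewrite (delta_sgn_prod t0 act2P heckeTY Yv0) -/c !scalerA /k.
  by rewrite mulrAC divfK // divff // scale1r.
by exists phi; split=> //; exists psi.
Qed.
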